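(* Suppose that the localization parameter $\delta_n$ satisfies $\sqrt{n}\,\delta_n^2\to\infty$ and that the preliminary estimator satisfies $\|\tilde{\mu}-\mu\| = o_p(\delta_n)$. Assume that $f$ satisfies: (A1) $f$ extends to $D^\varepsilon$ for some $\varepsilon>0$ and belongs to the isotropic Hölder class $\mathcal{H}_d(\alpha,L,D^\varepsilon)$ with $L>0$ and $\alpha>2$; (A2) there is a unique point $\mu$ in the interior of $D$ that maximizes $f$ on $D$, with $M=f(\mu)=\sup_{x\in D}f(x)$, and $\lambda_{\max}(Hf(\mu))<0$. Then the two-stage estimator $(\hat\mu,\hat M)$ satisfies, as $n\to\infty$, $$\|\hat{\mu}-\mu\| =O_p\bigl(n^{-1/2}\delta_n^{-1}\bigr)+O_p\bigl(\delta_n^{\alpha-1}\bigr)$$ and $$\hat{M}-M = O_p\bigl(n^{-1/2}\bigr)+O_p\bigl(\delta_n^{\alpha}\bigr).$$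
   Context: Notation. $\|\cdot\|$ is the Euclidean norm on $\mathbb{R}^d$. For a multi-index $\mathbf{i}=(i_1,\dots,i_d)\in\mathbb{N}^d$ ($0\in\mathbb{N}$), $|\mathbf{i}|=\sum_k i_k$, $\mathbf{i}!=\prod_k i_k!$, $x^{\mathbf{i}}=\prod_k x_k^{i_k}$, $\mathbf{D}^{\mathbf{i}}f$ is the corresponding partial derivative. $Hf(x)$ is the Hessian matrix of $f$ at $x$; $\lambda_{\max}$ is the largest eigenvalue. $r_\alpha=\lceil\alpha-1\rceil$ is the largest integer strictly less than $\alpha$; $\mathbb{I}=\{\mathbf{i}\in\mathbb{N}^d: |\mathbf{i}|\le r_\alpha\}$. For $a\in\mathbb{R}^d$, $\delta>0$, $C(a,\delta)=\prod_{k=1}^d[a_k-\delta,a_k+\delta]$. All asymptotics are as $n\to\infty$, with $f$, $d$, $\alpha$ fixed; $O_p,o_p$ denote boundedness/convergence to zero in probability. Hölder class. $D\subset\mathbb{R}^d$ is compact and convex, $D^\varepsilon=\bigcup_{x\in D}B(x,\varepsilon)$ with $B(x,\varepsilon)$ the closed ball. $\mathcal{H}_d(\alpha,L,D^\varepsilon)$ is the set of $r_\alpha$-times differentiable $f:D^\varepsilon\to\mathbb{R}$ with $|f(x)-P_{f,x_0}(x)|\le L\|x-x_0\|^\alpha$ for all $x,x_0\in D^\varepsilon$, where $P_{f,x_0}(x)=\sum_{\mathbf{i}\in\mathbb{I}}\frac{1}{\mathbf{i}!}\mathbf{D}^{\mathbf{i}}f(x_0)(x-x_0)^{\mathbf{i}}$.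 Model. One can observe $Y=f(x)+\xi$ at chosen design points $x$; the errors $\xi$ of different observations are independent with mean zero and variance $\sigma^2$. Two-stage procedure, with total budget $n=n_1+n_2$. First stage: $0<n_1<n$ with $n_1/n\to\upsilon\in(0,1)$. One observes $f$ with error at $n_1$ design points $\tilde x_1,\dots,\tilde x_{n_1}$ spread approximately uniformly over $D$ (for some $c_1,c_2>0$ the balls $B(\tilde x_i,c_1n^{-1/d})$ cover $D$ and $\|\tilde x_i-\tilde x_j\|\ge c_2n^{-1/d}$ for $i\ne j$). The preliminary consistent estimator $\tilde\mu$ of $\mu$ is a $D$-valued measurable function of the first-stage data. Second stage: let $l$ be the smallest integer with $2l\ge r_\alpha$, and assume $n_2=n_3(2l+1)^d$ with $n_3\in\mathbb{N}$. The localization parameter is a deterministic sequence $\delta_n>0$, $\delta_n\to0$ ($n$ is large enough that $C(x,l\delta_n)\subset D^\varepsilon$ for every $x\in D$). The second-stage design points $x_1,\dots,x_{n_2}$ consist of each of the $(2l+1)^d$ points of $\prod_{k=1}^d\{\tilde\mu_k+j\delta_n: j=0,\pm1,\dots,\pm l\}$ repeated exactly $n_3$ times, and one observes $Y_k=f(x_k)+\xi_k$, $k=1,\dots,n_2$ (errors $\xi_k$ independent of the first-stage data). For $\vartheta=(\vartheta_{\mathbf{i}})_{\mathbf{i}\in\mathbb{I}}$ put $f_\vartheta(x)=\sum_{\mathbf{i}\in\mathbb{I}}\vartheta_{\mathbf{i}}x^{\mathbf{i}}$, and let $\tilde\vartheta$ be the (unique) minimizer of $\sum_{k=1}^{n_2}(Y_k-f_\vartheta(x_k))^2$.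 The two-stage estimator is $\hat\mu=\arg\max_{x\in C(\tilde\mu,l\delta_n)}f_{\tilde\vartheta}(x)$ (any measurable maximizer), $\hat M=f_{\tilde\vartheta}(\hat\mu)$. *)

(* Defs.v *)
From HB Require Import structures.
From mathcomp Require Import all_boot all_order all_algebra.
From mathcomp Require Import all_classical all_reals all_analysis.

Set Implicit Arguments.
Unset Strict Implicit.
Unset Printing Implicit Defensive.

Import Order.TTheory GRing.Theory Num.Theory.
Import numFieldNormedType.Exports.

Local Open Scope classical_set_scope.
Local Open Scope ring_scope.

(* The norm that comes with 'rV[R]_d is the sup norm;
   it is used only through the topology it induces (compactness, interior,
   differentiability). Distances are measured with [enorm]. *)

Section Euclidean.
Context {R : realType} {d : nat}.

Definition enorm (x : 'rV[R]_d) : R := Num.sqrt (\sum_(k < d) x 0 k ^+ 2).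

Definition enlarge (D : set 'rV[R]_d) (e : R) : set 'rV[R]_d :=
  \bigcup_(x in D) [set y | enorm (y - x) <= e].

Definition cube (a : 'rV[R]_d) (h : R) : set 'rV[R]_d :=
  [set x | forall k, a 0 k - h <= x 0 k <= a 0 k + h].

Definition lambda_max (A : 'M[R]_d) : R := sup [set a | eigenvalue A a].

End Euclidean.

(* The multi-indices i with |i| <= r; each entry is then automatically at
   most r. *)
Definition mindex (d r : nat) : finType :=
  {i : {ffun 'I_d -> 'I_r.+1} | (\sum_k i k <= r)%N}.

Section Multiindex.
Context {R : realType} {d r : nat}.
Implicit Types (i : mindex d r) (x : 'rV[R]_d).

Definition mpart i (k : 'I_d) : nat := val i k.

Definition mfact i : nat := (\prod_k (mpart i k)`!)%N.

Definition mono i x : R := \prod_k x 0 k ^+ mpart i k.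

Definition poly_fun (theta : {ffun mindex d r -> R}) x : R :=
  \sum_i theta i * mono i x.

End Multiindex.

(* Derivatives are taken relatively to the domain A of the function, i.e.
   along the filter [within A (nbhs x)], so that only the values of f on A
   matter, also at boundary points of A. The domains used here are convex with
   nonempty interior, on which these (Frechet) derivatives are unique. *)
Section Derivatives.
Context {R : realType} {d : nat} (A : set 'rV[R]_d).
Implicit Types f : 'rV[R]_d -> R.

Definition diff_in f (x : 'rV[R]_d) : Prop :=
  differentiable f (within A (nbhs x)).

Definition partial (k : 'I_d) f (x : 'rV[R]_d) : R :=
  'd f (within A (nbhs x)) (delta_mx 0 k).

Fixpoint ndiff_in (r : nat) f : Prop :=
  if r is r'.+1 then
    (forall x, A x -> diff_in f x) /\ (forall k, ndiff_in r' (partial k f))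
  else True.

Definition mderiv {r : nat} (i : mindex d r) f : 'rV[R]_d -> R :=
  foldr (fun k g => iter (mpart i k) (partial k) g) f (enum 'I_d).

Definition hessian f (x : 'rV[R]_d) : 'M[R]_d :=
  \matrix_(j, k) partial j (partial k f) x.

End Derivatives.

(* For alpha > 1, [holder_order alpha] is the largest integer strictly less
   than alpha. *)
Definition holder_order {R : realType} (alpha : R) : nat :=
  `|Num.ceil (alpha - 1)|%N.

Definition taylor {R : realType} {d : nat} (r : nat) (A : set 'rV[R]_d)
    (f : 'rV[R]_d -> R) (x0 x : 'rV[R]_d) : R :=
  \sum_(i : mindex d r) (mfact i)%:R^-1 * mderiv A i f x0 * mono i (x - x0).

Definition holder_class {R : realType} {d : nat} (alpha L : R)
    (A : set 'rV[R]_d) : set ('rV[R]_d -> R) :=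
  [set f | ndiff_in A (holder_order alpha) f /\
    forall x x0, A x -> A x0 ->
      `|f x - taylor (holder_order alpha) A f x0 x|
        <= L * enorm (x - x0) `^ alpha].

Section Probability.
Context {R : realType}.

Definition mutually_independent {disp} {T : measurableType disp}
    (P : probability T R) (I : finType) (X : I -> {RV P >-> R}) : Prop :=
  forall (J : {set I}) (B : I -> set R), (forall i, measurable (B i)) ->
    P (\bigcap_(i in [set` J]) (X i @^-1` B i)) =
    (\prod_(i in J) P (X i @^-1` B i))%E.

(* Stochastic orders, for variables Z n living on possibly different
   probability spaces (T n, P n). *)
Context {disp : measure_display} {T : nat -> measurableType disp}.
Context (P : forall n, probability (T n) R).

Definition bigOp (Z : forall n, T n -> R) (a : nat -> R) : Prop :=
  forall e : R, 0 < e -> exists2 K : R, 0 < K &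
    \forall n \near \oo, (P n [set w | (K * a n < `|Z n w|)%R] <= e%:E)%E.

Definition littleop (Z : forall n, T n -> R) (a : nat -> R) : Prop :=
  forall e : R, 0 < e ->
    (fun n => P n [set w | e * a n < `|Z n w|]) @ \oo --> 0%E.

(* Z = O_p(a) + O_p(b) *)
Definition bigOp_add (Z : forall n, T n -> R) (a b : nat -> R) : Prop :=
  exists U V : forall n, {RV (P n) >-> R},
    [/\ \forall n \near \oo, forall w, Z n w = U n w + V n w,
        bigOp (fun n => U n) a & bigOp (fun n => V n) b].

End Probability.

(* Index set of the second-stage grid: the value j of a coordinate stands for
   the integer j - l in {-l, ..., l}. *)
Definition gindex (d l : nat) : finType := {ffun 'I_d -> 'I_(l.*2.+1)}.

(* Labels of the observations: m first-stage ones, and q replications at each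
   point of the second-stage grid. *)
Definition obs (d l m q : nat) : finType := ('I_m + gindex d l * 'I_q)%type.

Section Design.
Context {R : realType} {d : nat}.

(* The m design points z are spread approximately uniformly over D when
   observations number n overall. *)
Definition approx_uniform (D : set 'rV[R]_d) (c1 c2 : R) (n m : nat)
    (z : 'I_m -> 'rV[R]_d) : Prop :=
  [/\ forall i, D (z i),
      forall x, D x -> exists i, enorm (x - z i) <= c1 * n%:R `^ (- d%:R^-1) &
      forall i j, i != j -> c2 * n%:R `^ (- d%:R^-1) <= enorm (z i - z j)].

Definition grid_point {l : nat} (a : 'rV[R]_d) (h : R) (j : gindex d l) :
    'rV[R]_d :=
  \row_k (a 0 k + ((j k)%:R - l%:R) * h).

(* Coordinatewise measurability, i.e. measurability for the Borel sets. *)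
Definition measurable_vec {disp} {T : measurableType disp}
    (g : T -> 'rV[R]_d) : Prop :=
  forall k, measurable_fun [set: T] (fun w => g w 0 k).

Definition rss {r : nat} {I : finType} (x : I -> 'rV[R]_d) (Y : I -> R)
    (theta : {ffun mindex d r -> R}) : R :=
  \sum_i (Y i - poly_fun theta (x i)) ^+ 2.

End Design.

(* Main.v *)
(** Let p be the Taylor polynomial of f at mu and e_j the average residual of the
    replicated observations at the j-th grid point, measured from p: its bias
    part is O(delta^alpha) by the Hoelder condition, its noise part is
    O_p(n^(-1/2)) by Chebyshev, the errors being pairwise uncorrelated.  Comparing the
    residual sums of squares of the fitted polynomial g and of p bounds g - p at
    every grid point by 2 sum_j |e_j|.  Since 2 l >= r, tensor Lagrange
    interpolation recovers g - p on the whole cube from the grid, with basis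
    functions that are bounded and Lipschitz in the variable rescaled by
    delta; hence g - p is O(sum |e_j|) on the cube with Lipschitz constant
    O(sum |e_j| / delta).  Finally p(mu) - p(x) >= c |x - mu|^2 near mu, so that
    g(muh) >= g(mu) gives c |muh - mu|^2 <= Lip(g - p) |muh - mu|; no gradient of
    g has to vanish, and muh may lie on the boundary of the cube. *)

Require Import Defs.
From HB Require Import structures.
From mathcomp Require Import all_boot all_order all_algebra.
From mathcomp Require Import all_classical all_reals all_analysis.
From mathcomp Require Import measurable_realfun ring lra.

Set Implicit Arguments.
Unset Strict Implicit.
Unset Printing Implicit Defensive.

Import Order.TTheory GRing.Theory Num.Theory.
Import numFieldNormedType.Exports.

Local Open Scope classical_set_scope.
Local Open Scope ring_scope.

(** * Least squares and polynomial interpolation *)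

Section LeastSquares.
Variable R : realFieldType.

(** The grid is random, so the comparison is made pathwise, with constants fixed before the centre
    and the step, on the event that the preliminary estimator lies within delta of mu. The noise
    term involves the second-stage errors alone, so its tail is estimated without conditioning on
    the first stage. A second obstacle is measurability: the conclusion asks for random variables,
    while the minimizing coefficients are picked pathwise. The fitted values are therefore shown to
    be a fixed linear function of the observations, and the fitted maximum is recovered from them by
    interpolation. A third one is regularity: when alpha <= 3 the class provides two orders of
    differentiability and says nothing directly about continuity of the second derivatives. The
    symmetry of the Hessian and the second-order expansion are derived from differentiability of the
    gradient at mu, and the coefficients of p are never computed: the Hoelder condition with alpha >
    2 transfers the quadratic decrease from f to p. *)

Lemma quad_linear0 (a b : R) : (forall t, 0 <= a * t ^+ 2 - b * t) -> b = 0.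
Proof.
move=> h; apply/eqP/negP => /negP b0.
have a0 : 0 <= a.
  have := h 1; have := h (-1); rewrite !expr2 !mulr1 mulrNN mulr1; lra.
(* The minimizer would be b / (2 a), but a may vanish; with a + 1 in place of a the value is still
   negative. *)
have := h (b / (2 * (a + 1))).
have a1 : 2 * (a + 1) != 0 by lra.
have -> : a * (b / (2 * (a + 1))) ^+ 2 - b * (b / (2 * (a + 1))) =
   - (b ^+ 2 * (a + 2) / (2 * (a + 1)) ^+ 2) by field; lra.
rewrite oppr_ge0 leNgt => /negP; apply.
rewrite divr_gt0 ?exprn_gt0 //; last lra.
by rewrite mulr_gt0 ?exprn_even_gt0 //; lra.
Qed.

(** Moving one coefficient by t changes the criterion by a quadratic polynomial in t without
    constant term, to which [quad_linear0] applies. *)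
Lemma normal_equations (I J : finType) (e : J -> I -> R) (Y : I -> R)
    (q : J -> R) :
  (forall q' : J -> R, \sum_i (Y i - \sum_j q j * e j i) ^+ 2
     <= \sum_i (Y i - \sum_j q' j * e j i) ^+ 2) ->
  forall j, \sum_i (Y i - \sum_j' q j' * e j' i) * e j i = 0.
Proof.
move=> qmin j0; pose r i := Y i - \sum_j q j * e j i.
suff : 2 * (\sum_i r i * e j0 i) = 0 by rewrite -/r; lra.
apply: (@quad_linear0 (\sum_i e j0 i ^+ 2)) => t.
have := qmin (fun j => q j + (if j == j0 then t else 0)).
rewrite -subr_ge0 -sumrB; congr (0 <= _).
rewrite mulr_sumr !mulr_suml -sumrB; apply: eq_bigr => i _.
have -> : \sum_j (q j + (if j == j0 then t else 0)) * e j i =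
    \sum_j q j * e j i + t * e j0 i.
  under eq_bigr do rewrite mulrDl; rewrite big_split/=; congr (_ + _).
  rewrite (bigD1 j0)//= eqxx big1 ?addr0// => k /negPf ->.
  by rewrite mul0r.
rewrite /r; ring.
Qed.

(** The minimizer may fail to be unique, but the fitted values are always the orthogonal projection
    of Y onto the row space of the design. Writing the projection with a row basis B, whose Gram
    matrix is invertible, gives a matrix [Pi] that does not depend on Y. *)
Lemma lsq_fit (I J : finType) (e : J -> I -> R) :
  exists Pi : I -> I -> R, forall (Y : I -> R) (q : J -> R),
  (forall q' : J -> R, \sum_i (Y i - \sum_j q j * e j i) ^+ 2
     <= \sum_i (Y i - \sum_j q' j * e j i) ^+ 2) ->
  forall i, \sum_j q j * e j i = \sum_k Pi i k * Y k.
Proof.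
pose E := \matrix_(a < #|J|, b < #|I|) e (enum_val a) (enum_val b).
pose B := row_base E.
(* If v B B^T = 0 then |v B|^2 = 0, and the rows of B are independent. *)
have BBu : B *m B^T \in unitmx.
  rewrite -row_free_unit -kermx_eq0; apply/eqP/row_matrixP => a.
  rewrite row0; set v := row a _.
  have vB : v *m B *m B^T = 0.
    by rewrite -mulmxA /v -row_mul mulmx_ker row0.
  have vB0 : v *m B = 0.
    have : (v *m B *m (v *m B)^T) 0 0 = 0.
      by rewrite trmx_mul mulmxA vB mul0mx mxE.
    rewrite mxE => /eqP; rewrite psumr_eq0; last first.
      by move=> b _; rewrite [_^T _ _]mxE -expr2 sqr_ge0.
    move=> /allP h; apply/rowP => b; rewrite [RHS]mxE.
    have := h b (mem_index_enum _).
    by rewrite [X in _ * X]mxE -expr2 sqrf_eq0 => /eqP.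
  by apply: (row_free_inj (row_base_free E)); rewrite vB0 mul0mx.
pose Pm := B^T *m invmx (B *m B^T) *m B.
exists (fun i k => Pm (enum_rank k) (enum_rank i)) => Y q qmin i.
pose Yr : 'rV_#|I| := \row_b Y (enum_val b).
pose qr : 'rV_#|J| := \row_a q (enum_val a).
have qE b : (qr *m E) 0 b = \sum_j q j * e j (enum_val b).
  rewrite mxE (reindex (@enum_rank J)) /=; last first.
    by apply: onW_bij; exact: enum_rank_bij.
  by apply: eq_bigr => j _; rewrite !mxE enum_rankK.
have rE b : (Yr - qr *m E) 0 b =
    Y (enum_val b) - \sum_j q j * e j (enum_val b).
  by rewrite -qE !mxE.
have RE : (Yr - qr *m E) *m E^T = 0.
  apply/rowP => a; rewrite [RHS]mxE mxE.
  rewrite -[RHS](normal_equations qmin (enum_val a)).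
  rewrite (reindex (@enum_rank I)) /=; last first.
    by apply: onW_bij; exact: enum_rank_bij.
  by apply: eq_bigr => k _; rewrite rE !mxE !enum_rankK.
have /submxP[D BE] : (B <= E)%MS by rewrite eq_row_base.
have /submxP[c Fc] : (qr *m E <= B)%MS by rewrite eq_row_base submxMl.
have RB : (Yr - qr *m E) *m B^T = 0.
  by rewrite BE trmx_mul mulmxA RE mul0mx.
have cE : c = Yr *m B^T *m invmx (B *m B^T).
  move/eqP: RB; rewrite mulmxBl subr_eq0 => /eqP ->.
  by rewrite Fc -(mulmxA c) mulmxK.
have -> : \sum_j q j * e j i = (qr *m E) 0 (enum_rank i).
  by rewrite qE enum_rankK.
have -> : qr *m E = Yr *m Pm by rewrite Fc cE /Pm !mulmxA.
rewrite mxE.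
rewrite (reindex (@enum_rank I)) /=; last first.
  by apply: onW_bij; exact: enum_rank_bij.
by apply: eq_bigr => k _; rewrite mxE enum_rankK mulrC.
Qed.

End LeastSquares.

(** * Tensor Lagrange interpolation on the grid, and affine changes of variable *)

Section Interpolation.
Context {R : realType} {d : nat}.
Implicit Types (x a : 'rV[R]_d).

Definition node (l m : nat) : R := m%:R - l%:R.

Lemma node_inj l : injective (node l).
Proof. by move=> m n /addIr/eqP; rewrite eqr_nat => /eqP. Qed.

Definition lag1 (l : nat) (m : 'I_l.*2.+1) : {poly R} :=
  tnth (lagrange l.*2.+1 (node l)) m.

(** The argument is the rescaled variable u = (x - a) / h, in which the grid is always {-l, ...,
    l}^d; bounds on [lag] are thus independent of a and h. *)
Definition lag (l : nat) (j : gindex d l) (u : 'rV[R]_d) : R :=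
  \prod_k (lag1 (j k)).[u 0 k].

(** With s = (t - a) / h, the power t^i is the value at s of (a + h X)^i, of degree at most 2 l,
    which its values at the 2 l + 1 nodes determine. *)
Lemma exp_lagrange l (a h t : R) i : h != 0 -> (i <= l.*2)%N ->
  t ^+ i = \sum_(m < l.*2.+1) (lag1 m).[h^-1 * (t - a)] * (a + node l m * h) ^+ i.
Proof.
move=> h0 il; pose p : {poly R} := (a%:P + h *: 'X) ^+ i.
have sp : (size p <= l.*2.+1)%N.
  apply: (leq_trans (size_poly_exp_leq _ _)); rewrite ltnS.
  apply: leq_trans il; rewrite -[leqRHS]mul1n leq_mul2r -subn1 leq_subLR addn1.
  apply/orP; right; apply: (leq_trans (size_polyD _ _)).
  rewrite geq_max (leq_trans (size_polyC_leq1 _))//=.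
  by rewrite (leq_trans (size_scale_leq _ _)) ?size_polyX.
have := lagrange_gen (ltn0Sn _) (@node_inj l) sp.
move=> /(congr1 (fun p => p.[h^-1 * (t - a)])).
rewrite /p horner_exp hornerD hornerC hornerZ hornerX mulVKf// subrKC => ->.
rewrite horner_sum; apply: eq_bigr => m _.
rewrite hornerM hornerC horner_exp hornerD hornerC hornerZ hornerX.
by rewrite mulrC /lag1 (mulrC h).
Qed.

(** Each single exponent is at most 2 l, so every coordinate is interpolated separately;
    distributing the product of the d sums yields one term per choice of a node in each coordinate,
    that is, per grid index. *)
Lemma mono_lagrange r l (i : mindex d r) a (h : R) x : h != 0 ->
  (r <= l.*2)%N ->
  mono i x = \sum_(j : gindex d l) lag j (h^-1 *: (x - a)) * mono i (grid_point a h j).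
Proof.
move=> h0 rl; rewrite /mono.
have il k : (mpart i k <= l.*2)%N by rewrite (leq_trans _ rl)// -ltnS ltn_ord.
under eq_bigr => k _ do rewrite (exp_lagrange (a 0 k) _ h0 (il k)).
rewrite bigA_distr_bigA/=; apply: eq_bigr => j _.
rewrite /lag -big_split/=; apply: eq_bigr => k _; rewrite /node !mxE//.
Qed.

Lemma poly_fun_lagrange r l (theta : {ffun mindex d r -> R}) a (h : R) x :
  h != 0 -> (r <= l.*2)%N ->
  poly_fun theta x = \sum_(j : gindex d l)
    lag j (h^-1 *: (x - a)) * poly_fun theta (grid_point a h j).
Proof.
move=> h0 rl; rewrite /poly_fun.
under eq_bigr => i _ do rewrite (mono_lagrange _ a _ h0 rl) mulr_sumr.
rewrite exchange_big/=; apply: eq_bigr => j _; rewrite mulr_sumr.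
by apply: eq_bigr => i _; rewrite mulrCA.
Qed.

(** The total degree does not increase: in the binomial expansion, an exponent vector of total
    degree above r exceeds i in some coordinate, where the binomial coefficient is zero. The
    remaining vectors are exactly the elements of [mindex d r]. *)
Lemma mono_affine r (i : mindex d r) (c : 'rV[R]_d) (h : R) :
  exists theta : {ffun mindex d r -> R},
    forall x, mono i (h *: x + c) = poly_fun theta x.
Proof.
pose co k (m : 'I_r.+1) : R :=
  (c 0 k ^+ (mpart i k - m) * h ^+ m) *+ 'C(mpart i k, m).
exists [ffun j : mindex d r => \prod_k co k (val j k)] => x.
rewrite /mono.
have e k : (h *: x + c) 0 k ^+ mpart i k =
    \sum_(m < r.+1) co k m * x 0 k ^+ m.
  rewrite !mxE addrC exprDn.
  have ik : (mpart i k < r.+1)%N by rewrite ltn_ord.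
  rewrite (big_ord_widen_cond _ predT (fun m =>
     (c 0 k ^+ (mpart i k - m) * (h * x 0 k) ^+ m) *+ 'C(mpart i k, m)) ik).
  rewrite [RHS](bigID (fun m : 'I_r.+1 => (m < (mpart i k).+1)%N))/=.
  rewrite [X in _ = _ + X]big1 ?addr0; last first.
    by move=> m mi; rewrite /co bin_small ?mulr0n ?mul0r // ltnNge -ltnS.
  by apply: eq_bigr => m _; rewrite /co exprMn mulrA mulrnAl.
under eq_bigr => k _ do rewrite e.
rewrite bigA_distr_bigA/=.
rewrite (bigID (fun g : {ffun 'I_d -> 'I_r.+1} => (\sum_k g k <= r)%N))/=.
rewrite [X in _ + X]big1 ?addr0; last first.
  move=> g; rewrite -ltnNge => gr.
  have [k ik|] := pickP (fun k => (mpart i k < g k)%N).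
    by rewrite (bigD1 k)//= /co bin_small// mulr0n !mul0r.
  move=> h1; exfalso; move: gr; rewrite ltnNge => /negP; apply.
  apply: leq_trans (valP i); apply: leq_sum => k _.
  by rewrite leqNgt h1.
pose F g := \prod_k (co k (g k) * x 0 k ^+ (g k : nat)).
rewrite (big_sub _ (fun g : {ffun 'I_d -> 'I_r.+1} => F g))/=.
apply: eq_bigr => j _; rewrite ffunE /F big_split//.
Qed.

Lemma poly_fun_sum_affine r (I : finType) (w : I -> R)
    (m : I -> mindex d r) (c : 'rV[R]_d) (h : R) :
  exists theta : {ffun mindex d r -> R},
    forall x, \sum_i w i * mono (m i) (h *: x + c) = poly_fun theta x.
Proof.
have /choice[th hth] i := mono_affine (m i) c h.
exists [ffun j => \sum_i w i * th i j] => x.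
under eq_bigr => i _ do rewrite hth /poly_fun mulr_sumr.
rewrite exchange_big/=; apply: eq_bigr => j _; rewrite ffunE mulr_suml.
by apply: eq_bigr => i _; rewrite mulrA.
Qed.

Lemma poly_fun_affine r (theta : {ffun mindex d r -> R}) c (h : R) :
  exists theta' : {ffun mindex d r -> R},
    forall x, poly_fun theta (h *: x + c) = poly_fun theta' x.
Proof. exact: (poly_fun_sum_affine theta id). Qed.

Lemma taylor_poly_fun r (A : set 'rV[R]_d) f x0 :
  exists theta : {ffun mindex d r -> R},
    forall x, taylor r A f x0 x = poly_fun theta x.
Proof.
have [th hth] := poly_fun_sum_affine
  (fun i : mindex d r => (mfact i)%:R^-1 * mderiv A i f x0) id (- x0) 1.
by exists th => x; rewrite -hth; apply: eq_bigr => i _; rewrite scale1r.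
Qed.

End Interpolation.

(** * Second-order expansion at the maximum *)

Section Norms.
Context {R : realType} {d : nat}.
Implicit Types x y : 'rV[R]_d.

Lemma coord_le_norm x k : `|x 0 k| <= `|x|.
Proof.
rewrite [leRHS]mx_normrE.
exact: (le_bigmax _ (fun ij : 'I_1 * 'I_d => `|x ij.1 ij.2|) (0, k)).
Qed.

Lemma norm_le_coord x (c : R) : 0 <= c -> (forall k, `|x 0 k| <= c) -> `|x| <= c.
Proof.
move=> c0 h; rewrite [leLHS]mx_normrE; apply/bigmax_leP; split => // -[i k] _.
by rewrite /= ord1.
Qed.

Lemma enorm_ge0 x : 0 <= enorm x. Proof. exact: sqrtr_ge0. Qed.

Lemma enorm_sqr x : enorm x ^+ 2 = \sum_k x 0 k ^+ 2.
Proof. by rewrite sqr_sqrtr// sumr_ge0// => k _; rewrite sqr_ge0. Qed.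

Lemma enorm0 : enorm (0 : 'rV[R]_d) = 0.
Proof.
by rewrite /enorm big1 ?sqrtr0// => k _; rewrite mxE expr2 mul0r.
Qed.

Lemma enormZ (c : R) x : enorm (c *: x) = `|c| * enorm x.
Proof.
rewrite /enorm; under eq_bigr do rewrite mxE exprMn.
by rewrite -mulr_sumr sqrtrM ?sqr_ge0// sqrtr_sqr.
Qed.

Lemma coord_le_enorm x k : `|x 0 k| <= enorm x.
Proof.
rewrite -(@ler_pXn2r _ 2)// ?nnegrE ?enorm_ge0// enorm_sqr real_normK ?num_real//.
rewrite (bigD1 k)//= lerDl sumr_ge0// => j _; exact: sqr_ge0.
Qed.

Lemma norm_le_enorm x : `|x| <= enorm x.
Proof. by apply: norm_le_coord; [exact: enorm_ge0|exact: coord_le_enorm]. Qed.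

Lemma enorm_le_coord x (c : R) : (forall k, `|x 0 k| <= c) -> enorm x <= d%:R * c.
Proof.
move=> h.
have c0 : 0 <= d%:R * c.
  case: d x h => [|n] x h; first by rewrite mul0r.
  by rewrite mulr_ge0// (le_trans _ (h ord0)).
have xd : \sum_(k < d) `|x 0 k| <= d%:R * c.
  apply: le_trans (ler_sum _ (fun k _ => h k)) _.
  by rewrite sumr_const card_ord mulr_natl.
apply: le_trans xd.
rewrite -(@ler_pXn2r _ 2)// ?nnegrE ?enorm_ge0 ?sumr_ge0//.
rewrite enorm_sqr [leRHS]expr2 mulr_suml; apply: ler_sum => k _.
rewrite -real_normK ?num_real// expr2 ler_wpM2l// (bigD1 k)//= lerDl.
by rewrite sumr_ge0.
Qed.

Lemma enorm_le_norm x : enorm x <= d%:R * `|x|.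
Proof. by apply: enorm_le_coord => k; exact: coord_le_norm. Qed.

End Norms.

Section FilterEq.
Context {R : realType} {V : normedModType R}.

(** A differential is attached to a bundled filter, so identifying the derivative relative to A with
    the usual one at an interior point takes equality of the bundles, proofs included. *)
Lemma filter_on_eq (T : Type) (F G : filter_on T) :
  filter F = filter G -> F = G.
Proof.
case: F => F cF; case: G => G cG /= e; move: cF; rewrite e => cF.
by rewrite (Prop_irrelevance cF cG).
Qed.

Variable (A : set V) (x : V).
Hypothesis Ax : interior A x.

Let F := within_filter_on A (nbhs_filter_on x).

Let FE : F = nbhs_filter_on x.
Proof. by apply: filter_on_eq; exact: within_interior. Qed.

Lemma differentiable_within (f : V -> R) :
  differentiable f (within A (nbhs x)) -> differentiable f x.
Proof.
rewrite -[X in X -> _]/(@differentiable_def _ _ _ f F (Phantom _ (filter F))).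
by rewrite FE.
Qed.

Lemma diff_within (f : V -> R) :
  'd f (within A (nbhs x)) = 'd f x.
Proof.
rewrite -[LHS]/(@diff _ _ _ F (Phantom _ (filter F)) f).
by rewrite FE.
Qed.
End FilterEq.

(** * Symmetric Hessian and second-order expansion from a gradient differentiable at one point *)

Section SecondOrder.
Context {R : realType} {d : nat}.
Notation V := 'rV[R]_d.
Implicit Types (v w x : V).

Lemma is_derive_line (f : V -> R) x v (s : R) :
  differentiable f (x + s *: v) ->
  is_derive s 1 (fun s => f (x + s *: v)) ('d f (x + s *: v) v).
Proof.
move=> df.
have dl : is_diff s (fun s : R => x + s *: v) ( *:%R ^~ v).
  apply: (is_diff_eq (is_diffD (is_diff_cst x s) (is_diff_scalel s v))).
  exact: add0r.
have dc : is_diff s (f \o (fun s : R => x + s *: v)) ('d f (x + s *: v) \o *:%R ^~ v).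
  by apply: is_diff_comp; apply: differentiableP.
have dfs : differentiable (f \o (fun s : R => x + s *: v)) s by exact: ex_diff.
apply: DeriveDef; first exact/derivable1_diffP.
by rewrite deriveE// diff_val/= scale1r.
Qed.

Definition bform (A : 'M[R]_d) (u v : V) : R := \sum_j \sum_k u 0 j * v 0 k * A j k.

Lemma bform_Zl (A : 'M[R]_d) c u v : bform A (c *: u) v = c * bform A u v.
Proof.
rewrite /bform mulr_sumr; apply: eq_bigr => j _; rewrite mulr_sumr.
by apply: eq_bigr => k _; rewrite mxE !mulrA.
Qed.

Lemma bform_Zr (A : 'M[R]_d) c u v : bform A u (c *: v) = c * bform A u v.
Proof.
rewrite /bform mulr_sumr; apply: eq_bigr => j _; rewrite mulr_sumr.
by apply: eq_bigr => k _; rewrite mxE !mulrA (mulrC _ c).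
Qed.

Lemma bform_Dl (A : 'M[R]_d) u u' v :
  bform A (u + u') v = bform A u v + bform A u' v.
Proof.
rewrite /bform -big_split/=; apply: eq_bigr => j _; rewrite -big_split/=.
by apply: eq_bigr => k _; rewrite mxE !mulrDl.
Qed.

Lemma bform_delta (A : 'M[R]_d) i j :
  bform A (delta_mx 0 i) (delta_mx 0 j) = A i j.
Proof.
rewrite /bform (bigD1 i)//= (bigD1 j)//= !mxE !eqxx !mul1r big1 ?addr0.
  rewrite big1 ?addr0// => k ki; rewrite big1// => m _.
  by rewrite !mxE (negPf ki) !mul0r.
by move=> k kj; rewrite !mxE (negPf kj) mulr0 mul0r.
Qed.

Variables (f : V -> R) (mu : V) (g : 'I_d -> V -> R) (rho : R).
Hypothesis rho0 : 0 < rho.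
Hypothesis fd : forall x, `|x - mu| < rho -> differentiable f x.
Hypothesis fg : forall x k, `|x - mu| < rho -> g k x = 'd f x (delta_mx 0 k).
Hypothesis gd : forall k, differentiable (g k) mu.

Let H := \matrix_(j, k) 'd (g k) mu (delta_mx 0 j).
Let G v x := \sum_k v 0 k * g k x.

Lemma linear_coord (L : {linear V -> R}) v :
  L v = \sum_k v 0 k * L (delta_mx 0 k).
Proof.
rewrite [in LHS](row_sum_delta v) linear_sum; apply: eq_bigr => k _.
by rewrite linearZ.
Qed.

Lemma fG x v : `|x - mu| < rho -> 'd f x v = G v x.
Proof.
by move=> xr; rewrite linear_coord; apply: eq_bigr => k _; rewrite fg.
Qed.

Lemma bformE u v : bform H u v = \sum_k v 0 k * 'd (g k) mu u.
Proof.
rewrite /bform exchange_big/=; apply: eq_bigr => k _.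
rewrite [in RHS]linear_coord mulr_sumr; apply: eq_bigr => j _.
by rewrite /H mxE mulrA (mulrC (v 0 k)).
Qed.

Lemma gradient_expansion (e : R) : 0 < e -> exists2 r, 0 < r <= rho &
  forall v w, `|w| < r ->
    `|G v (mu + w) - G v mu - bform H w v| <= e * `|v| * `|w|.
Proof.
move=> e0.
(* The d coordinate errors add up to at most e; the + 1 keeps the denominator positive when d =
   0. *)
have e'0 : 0 < e / (d%:R + 1) by rewrite divr_gt0// ltr_wpDl.
have hk k : \forall w \near (0 : V),
    `|g k (w + mu) - g k mu - 'd (g k) mu w| <= e / (d%:R + 1) * `|w|.
  have /diff_locallyP[_ /eqaddoP/(_ _ e'0)] := gd k.
  apply: filterS => w /=.
  by rewrite opprD addrA.
have hn : \forall w \near (0 : V), forall k,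
    `|g k (w + mu) - g k mu - 'd (g k) mu w| <= e / (d%:R + 1) * `|w|.
  exact: (filter_forall _ hk).
move/nbhs_ballP: hn => [r0 /= r00 hr0].
exists (Num.min r0 rho); first by rewrite lt_min r00 rho0 ge_min lexx orbT.
move=> v w; rewrite lt_min => /andP[wr0 _].
have hw : ball (0 : V) r0 w by rewrite -ball_normE /ball_/= sub0r normrN.
have {}hk := hr0 _ hw.
rewrite bformE /G -!sumrB.
apply: le_trans (ler_norm_sum _ _ _) _.
have ek k : `|v 0 k * g k (mu + w) - v 0 k * g k mu - v 0 k * 'd (g k) mu w| <=
   `|v| * (e / (d%:R + 1) * `|w|).
  rewrite -!mulrBr normrM ler_pM// ?coord_le_norm//.
  by rewrite (addrC mu).
apply: le_trans (ler_sum _ (fun k _ => ek k)) _.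
rewrite sumr_const card_ord -[leLHS]mulr_natr.
have -> : `|v| * (e / (d%:R + 1) * `|w|) * d%:R =
   e * `|v| * `|w| * (d%:R / (d%:R + 1)).
  ring.
rewrite ler_piMr ?mulr_ge0// ?(ltW e0)//.
by rewrite ler_pdivrMr ?ltr_wpDl// mul1r lerDl.
Qed.

(* The mean value theorem for s |-> f (x + s v) - P s; the comparison function P is
   either f along a parallel segment or a quadratic polynomial. *)
Lemma line_mvt (x v : V) (P dP : R -> R) :
  (forall s : R, 0 <= s <= 1 -> `|x + s *: v - mu| < rho) ->
  (forall s : R, 0 <= s <= 1 -> is_derive s 1 P (dP s)) ->
  exists2 s, 0 < s < 1 & (f (x + v) - P 1) - (f x - P 0) = G v (x + s *: v) - dP s.
Proof.
move=> xv dPs.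
pose phi (s : R) := f (x + s *: v) - P s.
have dphi (s : R) : 0 <= s <= 1 -> is_derive s 1 phi (G v (x + s *: v) - dP s).
  move=> s01; rewrite -fG ?xv//.
  have := is_derive_line (fd (xv _ s01)) => ?; have := dPs _ s01 => ?.
  exact: is_deriveB.
have [|||s s01 e] := @MVT R phi (fun s => G v (x + s *: v) - dP s) 0 1.
- exact: ltr01.
- by move=> s; rewrite in_itv/= => /andP[s0 s1]; apply: dphi; rewrite !ltW.
- apply: derivable_within_continuous => s; rewrite in_itv/= => s01.
  by have := dphi _ s01; case.
exists s; first by move: s01; rewrite in_itv.
move: e; rewrite /phi !scale1r scale0r addr0 subr0 mulr1 => <-.
by [].
Qed.

(** The mean value theorem, applied to the difference of f on the two sides of the parallelogram
    parallel to v, turns the second difference into a difference of gradients at two points that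
    differ by t u. Both gradients are expanded around mu, the only point where they are known to be
    differentiable. *)
Lemma mixed_difference (e : R) u v : 0 < e -> `|u| <= 1 -> `|v| <= 1 ->
  exists2 r, 0 < r & forall t : R, 0 < t < r ->
    `|f (mu + t *: u + t *: v) - f (mu + t *: v) - (f (mu + t *: u) - f mu)
      - t ^+ 2 * bform H u v| <= e * t ^+ 2.
Proof.
move=> e0 u1 v1; have e3 : 0 < e / 3 by rewrite divr_gt0.
have [r /andP[r0 rrho] hr] := gradient_expansion e3.
(* The farther of the two points is within 2 t of mu. The two remainders are at most (e / 3) t (2 t)
   and (e / 3) t t, which explains the factor 1 / 3. *)
exists (r / 2); first by rewrite divr_gt0.
move=> t /andP[t0 tr].
have tv : `|t *: v| <= t by rewrite normrZ gtr0_norm// ler_piMr// ltW.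
have tu : `|t *: u| <= t by rewrite normrZ gtr0_norm// ler_piMr// ltW.
have stv (s : R) : 0 <= s <= 1 -> `|s *: (t *: v)| <= t.
  move=> /andP[s0 s1]; rewrite normrZ ger0_norm//.
  by apply: le_trans tv; rewrite ler_piMl.
have ustv (s : R) : 0 <= s <= 1 -> `|t *: u + s *: (t *: v)| <= 2 * t.
  move=> s01; apply: le_trans (ler_normD _ _) _.
  have := stv _ s01; lra.
have [||] := @line_mvt (mu + t *: u) (t *: v) (fun s => f (mu + s *: (t *: v)))
  (fun s => G (t *: v) (mu + s *: (t *: v))).
- move=> s s01; rewrite -(addrA mu) (addrC mu) addrK.
  by apply: le_lt_trans (ustv _ s01) _; lra.
- move=> s s01.
  have smu : `|mu + s *: (t *: v) - mu| < rho.
    rewrite (addrC mu) addrK.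
    by apply: le_lt_trans (stv _ s01) _; lra.
  rewrite -fG//.
  apply: is_derive_line; exact: fd.
move=> s /andP[s0 s1]; rewrite scale1r scale0r addr0 => ->.
have s01 : 0 <= s <= 1 by rewrite !ltW.
set a := t *: u + s *: (t *: v); set b := s *: (t *: v).
have := hr (t *: v) a; have := hr (t *: v) b.
have br : `|b| < r by apply: le_lt_trans (stv _ s01) _; lra.
have ar : `|a| < r by apply: le_lt_trans (ustv _ s01) _; lra.
move=> /(_ br) hb /(_ ar) ha.
have e1 : bform H a (t *: v) - bform H b (t *: v) = t ^+ 2 * bform H u v.
  by rewrite /a bform_Dl addrK bform_Zl bform_Zr expr2 mulrA.
have -> : mu + t *: u + b = mu + a by rewrite -(addrA mu).
have h1 : e / 3 * `|t *: v| * `|a| <= e / 3 * t * (2 * t).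
  apply: ler_pM => //; first by rewrite mulr_ge0// ltW.
    by rewrite ler_wpM2l// ltW.
  exact: ustv.
have h2 : e / 3 * `|t *: v| * `|b| <= e / 3 * t * t.
  apply: ler_pM => //; first by rewrite mulr_ge0// ltW.
    by rewrite ler_wpM2l// ltW.
  exact: stv.
rewrite -e1.
have -> : G (t *: v) (mu + a) - G (t *: v) (mu + b) -
    (bform H a (t *: v) - bform H b (t *: v)) =
  (G (t *: v) (mu + a) - G (t *: v) mu - bform H a (t *: v)) -
  (G (t *: v) (mu + b) - G (t *: v) mu - bform H b (t *: v)) by ring.
apply: le_trans (ler_normB _ _) _.
have -> : e * t ^+ 2 = e / 3 * t * (2 * t) + e / 3 * t * t by field.
by apply: lerD; [exact: le_trans ha h1|exact: le_trans hb h2].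
Qed.

(** The second difference is symmetric in its two directions, and is within a small multiple of t^2
    of both t^2 [H i j] and t^2 [H j i]. *)
Lemma second_partial_sym i j : H i j = H j i.
Proof.
apply/eqP; rewrite -subr_eq0; apply/eqP.
apply/eqP; rewrite -normr_eq0; apply/eqP.
apply/le_anti; rewrite normr_ge0 andbT; apply/ler_addgt0Pr => e e0; rewrite add0r.
have e2 : 0 < e / 2 by rewrite divr_gt0.
have n1 (k : 'I_d) : `|delta_mx 0 k : V| <= 1.
  apply: norm_le_coord => // k'; rewrite mxE; case: eqP => _; case: eqP => _ /=;
  by rewrite ?normr1 ?normr0.
have [r r0 hr] := mixed_difference e2 (n1 i) (n1 j).
have [r' r'0 hr'] := mixed_difference e2 (n1 j) (n1 i).
pose t := Num.min r r' / 2.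
have m0 : 0 < Num.min r r' by rewrite lt_min r0.
have t0 : 0 < t by rewrite divr_gt0.
have tm : t < Num.min r r' by rewrite /t; lra.
move: (tm); rewrite lt_min => /andP[tr tr'].
have := hr t; have := hr' t; rewrite t0 tr tr' !bform_delta => /(_ isT) h' /(_ isT) h.
rewrite -(ler_pM2r (exprn_gt0 2 t0)).
have -> : `|H i j - H j i| * t ^+ 2 = `|t ^+ 2 * H i j - t ^+ 2 * H j i|.
  by rewrite -mulrBr normrM (ger0_norm (sqr_ge0 t)) mulrC.
move: h h'.
rewrite (addrAC mu (t *: delta_mx 0 j)).
set x := f (mu + _ + _); set y := f (mu + _); set z := f (mu + _).
rewrite !ler_norml => /andP[? ?] /andP[? ?]; apply/andP; split; lra.
Qed.

Lemma taylor_young2 (e : R) : 0 < e -> exists2 r, 0 < r <= rho &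
  forall w, `|w| < r ->
    `|f (mu + w) - f mu - G w mu - 2^-1 * bform H w w| <= e * `|w| ^+ 2.
Proof.
move=> e0; have [r /andP[r0 rrho] hr] := gradient_expansion e0.
exists r; first by rewrite r0.
move=> w wr.
have sw (s : R) : 0 <= s <= 1 -> `|s *: w| <= `|w|.
  by move=> /andP[s0 s1]; rewrite normrZ ger0_norm// ler_piMl.
(* P is chosen so that its derivative is the first-order expansion at mu of the directional
   derivative at mu + s w; the mean value theorem then leaves only the remainder of
   [gradient_expansion]. *)
pose P (s : R) := s * G w mu + s ^+ 2 * (2^-1 * bform H w w).
pose dP (s : R) := G w mu + s * bform H w w.
have [||s /andP[s0 s1]] := @line_mvt mu w P dP.
- move=> s s01; rewrite (addrC mu) addrK.
  by apply: le_lt_trans (sw _ s01) _; apply: lt_le_trans wr _.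
- move=> s _; rewrite /P /dP.
  apply: is_derive_eq.
  by rewrite /GRing.scale/=; field.
rewrite /P /dP expr1n expr0n !mul1r !mul0r addr0 subr0 => e1.
have s01 : 0 <= s <= 1 by rewrite !ltW.
have := hr w (s *: w); rewrite bform_Zl.
have -> : f (mu + w) - f mu - G w mu - 2^-1 * bform H w w =
  G w (mu + s *: w) - G w mu - s * bform H w w by lra.
move=> h; apply: le_trans (h _) _; first exact: le_lt_trans (sw _ s01) _.
by rewrite expr2 mulrA ler_wpM2l ?mulr_ge0 ?(ltW e0)// sw.
Qed.

(** The expansion with remainder constant 1 gives t G <= t^2 (N - K) for all small t of both signs;
    a nonzero G would dominate the right-hand side for |t| small. *)
Lemma gradient0_at_max : (forall x, `|x - mu| < rho -> f x <= f mu) ->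
  forall v, G v mu = 0.
Proof.
move=> fmax v.
have [r /andP[r0 rrho] hr] := taylor_young2 ltr01.
pose K := 2^-1 * bform H v v; pose N := `|v| ^+ 2.
have N0 : 0 <= N by rewrite sqr_ge0.
have small t : `|t| * (`|v| + 1) < r -> t * G v mu <= t ^+ 2 * (N - K).
  move=> tr.
  have tv : `|t *: v| < r.
    by rewrite normrZ; apply: le_lt_trans tr; rewrite ler_wpM2l// lerDl.
  have := hr _ tv; rewrite bform_Zl bform_Zr normrZ exprMn real_normK ?num_real// mul1r.
  have -> : G (t *: v) mu = t * G v mu.
    by rewrite /G mulr_sumr; apply: eq_bigr => k _; rewrite mxE mulrA.
  have : f (mu + t *: v) <= f mu.
    by apply: fmax; rewrite (addrC mu) addrK (lt_le_trans tv).
  rewrite ler_norml /K /N => h1 /andP[h2 h3]; lra.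
apply/eqP; apply/negP => /negP g0.
have v1 : 0 < `|v| + 1 by rewrite ltr_wpDl.
have b0 : 0 < `|G v mu| by rewrite normr_gt0.
pose C := `|N - K| + 1.
have C0 : 0 < C by rewrite ltr_wpDl.
(* The first bound keeps q v in the range of the expansion, the second gives q C < |G|; the factors
   2 make both inequalities strict. *)
pose q := Num.min (r / (2 * (`|v| + 1))) (`|G v mu| / (2 * C)).
have q0 : 0 < q by rewrite lt_min !divr_gt0 ?mulr_gt0.
have q1 : q * (`|v| + 1) < r.
  have : q <= r / (2 * (`|v| + 1)) by rewrite ge_min lexx.
  rewrite ler_pdivlMr ?mulr_gt0// => ?.
  have := mulr_gt0 q0 v1; lra.
have q2 : q * C < `|G v mu|.
  have : q <= `|G v mu| / (2 * C) by rewrite ge_min lexx orbT.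
  rewrite ler_pdivlMr ?mulr_gt0// => ?.
  have := mulr_gt0 q0 C0; lra.
have key : q * `|G v mu| <= q ^+ 2 * (N - K).
  have [gp|gn] := leP 0 (G v mu).
    by rewrite ger0_norm//; apply: small; rewrite gtr0_norm.
  have := small (- q); rewrite normrN gtr0_norm// => /(_ q1).
  by rewrite sqrrN ltr0_norm// mulrN mulNr.
have : q * `|G v mu| <= q * (q * C).
  apply: le_trans key _; rewrite expr2 -mulrA !ler_pM2l//.
  by rewrite /C; have := ler_norm (N - K); lra.
by rewrite ler_pM2l// leNgt q2.
Qed.

End SecondOrder.

(** * The quadratic form of a symmetric matrix and its largest eigenvalue *)

Section Spectral.
Context {R : realType}.

Lemma continuous_bigsum (T : topologicalType) (I : Type) (s : seq I) (h : I -> T -> R) :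
  (forall i, continuous (h i)) -> continuous (fun x => \sum_(i <- s) h i x).
Proof.
move=> hc; elim: s => [|i s IH].
  by under eq_fun do rewrite big_nil; exact: cst_continuous.
under eq_fun do rewrite big_cons; move=> x.
by apply: cvgD; [exact: hc|exact: IH].
Qed.

Lemma bform_continuous d (A : 'M[R]_d) : continuous (fun v => bform A v v).
Proof.
apply: continuous_bigsum => j; apply: continuous_bigsum => k v.
apply: (@continuousM R 'rV[R]_d (fun x : 'rV[R]_d => x 0 j * x 0 k)
  (fun=> A j k)); last exact: cst_continuous.
by apply: continuousM; exact: coord_continuous.
Qed.

Lemma enorm_sqr_bform d (v : 'rV[R]_d) : enorm v ^+ 2 = bform 1%:M v v.
Proof.
rewrite enorm_sqr; apply: eq_bigr => j _.
rewrite (bigD1 j)//= mxE eqxx mulr1 big1 ?addr0 ?expr2// => k kj.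
by rewrite mxE eq_sym (negPf kj) mulr0n mulr0.
Qed.

Lemma bform_sym d (A : 'M[R]_d) u v : (forall i j, A i j = A j i) ->
  bform A u v = bform A v u.
Proof.
move=> As; rewrite /bform exchange_big/=; apply: eq_bigr => j _.
by apply: eq_bigr => k _; rewrite As (mulrC (u 0 k)).
Qed.

Lemma sphere_compact d : compact [set v : 'rV[R]_d | enorm v ^+ 2 = 1].
Proof.
apply: bounded_closed_compact.
  exists 1; split => // m m1 v /= v1; apply: ltW; apply: le_lt_trans m1.
  apply: le_trans (norm_le_enorm v) _.
  by rewrite -(@ler_pXn2r _ 2)// ?nnegrE ?enorm_ge0// v1 expr1n.
under eq_set do rewrite enorm_sqr_bform.
have -> : [set v : 'rV[R]_d | bform 1%:M v v = 1] =
    (fun v => bform 1%:M v v) @^-1` [set 1] by [].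
by apply: closed_comp => //; move=> v _; exact: bform_continuous.
Qed.

(** The eigenvalue is the maximum of the quadratic form on the Euclidean sphere, attained by
    compactness; d > 0 makes the sphere nonempty. *)
Lemma max_eigenvalue d (A : 'M[R]_d) : (0 < d)%N -> (forall i j, A i j = A j i) ->
  exists2 a, eigenvalue A a & forall v, bform A v v <= a * enorm v ^+ 2.
Proof.
move=> d0 As.
have S0 : [set v : 'rV[R]_d | enorm v ^+ 2 = 1] !=set0.
  exists (delta_mx 0 (Ordinal d0)).
  by rewrite /= enorm_sqr_bform bform_delta mxE eqxx.
have [c /set_mem/= c1 cmax] := EVT_max_rV S0 (@sphere_compact d)
  (continuous_subspaceT (@bform_continuous d A)).
pose a := bform A c c.
have amax v : bform A v v <= a * enorm v ^+ 2.
  have [v0|v0] := eqVneq (enorm v) 0.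
    have -> : v = 0.
      apply/eqP; rewrite -normr_le0.
      by rewrite (le_trans (norm_le_enorm v))// v0.
    by rewrite enorm0 -(scale0r (0 : 'rV[R]_d)) bform_Zl expr0n/= mulr0 mul0r.
  have vp : 0 < enorm v by rewrite lt_neqAle eq_sym v0 enorm_ge0.
  have := cmax ((enorm v)^-1 *: v).
  rewrite inE /= enormZ gtr0_norm ?invr_gt0// mulVf// expr1n => /(_ erefl).
  rewrite bform_Zl bform_Zr mulrA -expr2 exprVn mulrC ler_pdivrMr ?exprn_gt0//.
exists a => //; apply/eigenvalueP; exists c; last first.
  apply: contra_eq_neq c1 => ->; by rewrite enorm0 expr0n/= eq_sym oner_eq0.
(* A maximizer c on the sphere is an eigenvector: the quadratic polynomial
   a |c + t w|^2 - bform A (c + t w) (c + t w) is nonnegative and vanishes at t = 0,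
   hence has no linear term. *)
have key w : a * bform 1%:M c w = bform A c w.
  have : 2 * (bform A c w - a * bform 1%:M c w) = 0.
    apply: (@quad_linear0 _ (a * bform 1%:M w w - bform A w w)) => t.
    have := amax (c + t *: w).
    rewrite enorm_sqr_bform.
    have e (B : 'M[R]_d) : (forall i j, B i j = B j i) -> bform B (c + t *: w) (c + t *: w) =
       bform B c c + t * (2 * bform B c w) + t ^+ 2 * bform B w w.
      move=> Bs; rewrite bform_Dl (bform_sym c)// (bform_sym (t *: w))// !bform_Dl.
      rewrite !bform_Zl !bform_Zr (bform_sym w c)//; ring.
    rewrite !e//; last by move=> i j; rewrite !mxE eq_sym.
    rewrite -enorm_sqr_bform c1 -/a; lra.
  lra.
apply/rowP => i; rewrite !mxE.
have := key (delta_mx 0 i).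
have e (B : 'M[R]_d) : bform B c (delta_mx 0 i) = \sum_j c 0 j * B j i.
  apply: eq_bigr => j _; rewrite (bigD1 i)//= mxE !eqxx mulr1 big1 ?addr0// => k ki.
  by rewrite mxE (negPf ki) andbF mulr0n mulr0 mul0r.
rewrite !e => <-; congr (_ * _).
rewrite (bigD1 i)//= mxE eqxx mulr1 big1 ?addr0// => j ji.
by rewrite mxE (negPf ji) mulr0n mulr0.
Qed.

(** [sup] takes the value 0 on a set without supremum; the negative sign excludes this case, so that
    [lambda_max] really bounds the spectrum. *)
Lemma eigenvalue_le_lambda_max d (A : 'M[R]_d) a :
  lambda_max A < 0 -> eigenvalue A a -> a <= lambda_max A.
Proof.
move=> l0 ea; have [hs|hs] := pselect (has_sup [set a | eigenvalue A a]).
  exact: ub_le_sup hs.2 _ ea.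
by move: l0; rewrite /lambda_max sup_out// ltxx.
Qed.

End Spectral.

(** The threshold on N is the solution of L N^(alpha - 2) = k; alpha > 2 makes the Hoelder remainder
    negligible against a quadratic term. *)
Lemma powR_le_sqr (R : realType) (alpha L k N : R) : 2 < alpha -> 0 < L ->
  0 < k -> 0 <= N -> N <= (k / L) `^ (alpha - 2)^-1 ->
  L * N `^ alpha <= k * N ^+ 2.
Proof.
move=> al2 L0 k0 N0 Nk; have al : 0 < alpha - 2 by lra.
have -> : N `^ alpha = N ^+ 2 * N `^ (alpha - 2).
  rewrite -powR_mulrn// -powRD ?subrKC//.
  by apply/implyP => /eqP a0; exfalso; lra.
rewrite mulrCA [leRHS]mulrC ler_wpM2l ?sqr_ge0// mulrC -ler_pdivlMr//.
apply: (@le_trans _ _ (((k / L) `^ (alpha - 2)^-1) `^ (alpha - 2))).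
  by apply: ge0_ler_powR; rewrite ?nnegrE ?powR_ge0//; exact: ltW.
by rewrite -powRrM mulVf ?lt0r_neq0// powRr1// ltW// divr_gt0.
Qed.

(** * Quadratic decrease of the Taylor polynomial around the maximum *)

Section Peak.
Context {R : realType} {d : nat}.
Notation V := 'rV[R]_d.
Variables (D : set V) (f : V -> R) (eps alpha L : R) (mu : V).
Hypothesis d_gt0 : (0 < d)%N.
Hypothesis eps_gt0 : 0 < eps.
Hypothesis alpha_gt2 : 2 < alpha.
Hypothesis L_gt0 : 0 < L.
Let A := enlarge D eps.
Hypothesis f_holder : holder_class alpha L A f.
Hypothesis mu_int : interior D mu.
Hypothesis mu_max : forall y, D y -> f y <= f mu.
Hypothesis hess_neg : lambda_max (hessian A f mu) < 0.
Let r := holder_order alpha.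
Let p := taylor r A f mu.

Lemma sub_enlarge : D `<=` A.
Proof. by move=> x Dx; exists x => //=; rewrite subrr enorm0 ltW. Qed.

(** Here [|y - x|] is the sup norm, and the Euclidean norm is at most d times larger. *)
Lemma enlarge_interior x y : D x -> `|y - x| < eps / (d%:R + 1) -> interior A y.
Proof.
move=> Dx xy.
have d1 : 0 < d%:R + 1 :> R by rewrite ltr_wpDl.
have /open_nbhs_nbhs : open_nbhs y (ball x (eps / (d%:R + 1))).
  split; last by rewrite -ball_normE /= distrC.
  apply: ball_open; exact: divr_gt0.
apply: filterS => w; rewrite -ball_normE /= distrC => xw.
exists x => //=; apply: le_trans (enorm_le_norm _) _.
apply: (@le_trans _ _ (d%:R * (eps / (d%:R + 1)))); first by rewrite ler_wpM2l// ltW.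
rewrite mulrCA ler_piMr ?(ltW eps_gt0)// ler_pdivrMr// mul1r lerDl//.
Qed.

Lemma holder_order_ge2 : (2 <= r)%N.
Proof.
rewrite /r /holder_order.
have : (1 < Num.ceil (alpha - 1))%R by rewrite ceil_gt_int mulr1z ltrBrDr.
by case: (Num.ceil (alpha - 1)).
Qed.

Lemma sub_enlarge_interior : interior D `<=` interior A.
Proof. exact: (interiorS sub_enlarge). Qed.

Lemma enlarge_center : A mu.
Proof. by apply: sub_enlarge; exact: interior_subset. Qed.

(** The Hoelder condition at x = x0 has right-hand side 0, so no derivative of a monomial has to be
    evaluated. *)
Lemma taylor_at_center : p mu = f mu.
Proof.
have := f_holder.2 mu mu enlarge_center enlarge_center.
have a0 : 0 < alpha by apply: lt_trans alpha_gt2.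
rewrite subrr enorm0 powR0 ?mulr0; last exact: lt0r_neq0.
by rewrite normr_le0 subr_eq0 => /eqP.
Qed.

Lemma holder_differentiable x : interior A x -> differentiable f x.
Proof.
move=> Ax; have [h _] := f_holder; move: h; rewrite -/r.
case: r holder_order_ge2 => // r' _ [h _].
by apply: (differentiable_within Ax); apply: h; exact: interior_subset.
Qed.

Lemma partialE (B : set V) k (h : V -> R) x : interior B x ->
  partial B k h x = 'd h x (delta_mx 0 k).
Proof. by move=> Bx; rewrite /partial (diff_within Bx). Qed.

(** The decrease is proved for f, from its expansion and the negative Hessian, and passed to p by |f
    - p| <= L |x - mu|^alpha. *)
Lemma taylor_quadratic_peak : exists c rho, [/\ 0 < c, 0 < rho &
  forall x, enorm (x - mu) < rho -> c * enorm (x - mu) ^+ 2 <= p mu - p x].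
Proof.
have /nbhs_ballP[rho /= rho0 hrho] : nbhs mu (interior D) by exact: nbhs_interior.
have Drho x : `|x - mu| < rho -> interior D x.
  by move=> xr; apply: hrho; rewrite -ball_normE /= distrC.
pose g k := partial A k f.
have fd x : `|x - mu| < rho -> differentiable f x.
  by move=> /Drho/sub_enlarge_interior; exact: holder_differentiable.
have fg x k : `|x - mu| < rho -> g k x = 'd f x (delta_mx 0 k).
  by move=> /Drho/sub_enlarge_interior Ax; rewrite /g partialE.
have Amu := sub_enlarge_interior mu_int.
have gd k : differentiable (g k) mu.
  have [h _] := f_holder; move: h; rewrite -/r.
  case: r holder_order_ge2 => [|[|r']]// _ [_ h].
  by apply: (differentiable_within Amu); apply: (h k).1; exact: enlarge_center.
have HE : hessian A f mu = \matrix_(j, k) 'd (g k) mu (delta_mx 0 j).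
  apply/matrixP => j k; rewrite [LHS]mxE [RHS]mxE.
  exact: (partialE j (g k) Amu).
have Hsym i j : hessian A f mu i j = hessian A f mu j i.
  by rewrite HE; exact: (second_partial_sym rho0 fd fg gd).
have [a ea Ha] := max_eigenvalue d_gt0 Hsym.
have a0 : a < 0 by apply: le_lt_trans (eigenvalue_le_lambda_max hess_neg ea) _.
have e0 : 0 < - a / 8 by lra.
have [r1 /andP[r10 r1rho] hr1] := taylor_young2 rho0 fd fg gd e0.
have G0 := gradient0_at_max rho0 fd fg gd
  (fun x xr => mu_max (interior_subset (Drho x xr))).
pose K := - a / 8 / L.
have K0 : 0 < K by rewrite divr_gt0.
(* The Hessian contributes - a / 2; the remainder of the expansion and the Hoelder term each cost at
   most - a / 8, which leaves - a / 4. *)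
exists (- a / 4), (Num.min r1 (K `^ (alpha - 2)^-1)).
split; [lra|by rewrite lt_min r10 powR_gt0|].
move=> x; rewrite lt_min => /andP[xr1 xK].
have xn : `|x - mu| < r1 by apply: le_lt_trans (norm_le_enorm _) _.
have := hr1 _ xn; rewrite G0 -HE (addrC mu) subrK subr0 ler_norml => /andP[_ h1].
have := Ha (x - mu) => h2.
have Ax : A x.
  apply: sub_enlarge; apply: interior_subset; apply: Drho.
  exact: lt_le_trans r1rho.
have := f_holder.2 x mu Ax enlarge_center.
rewrite -/r -/p ler_norml => /andP[h3 _].
set N := enorm (x - mu) in xr1 xK h1 h2 h3 *.
have N0 : 0 <= N by exact: enorm_ge0.
have h4 : - a / 8 * `|x - mu| ^+ 2 <= - a / 8 * N ^+ 2.
  have xN : `|x - mu| <= N by exact: norm_le_enorm.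
  apply: ler_wpM2l; first exact: ltW.
  by apply: lerXn2r xN; rewrite nnegrE.
have h5 : L * N `^ alpha <= - a / 8 * N ^+ 2.
  exact: powR_le_sqr (ltW xK).
by rewrite taylor_at_center; lra.
Qed.

End Peak.

(** * Error of the fitted maximum *)

Section BoundedLipschitz.
Context {R : realType} {d : nat}.
Notation V := 'rV[R]_d.
Variable S : set V.

(** Boundedness is carried along because a product of Lipschitz functions need not be Lipschitz
    without it, and [lag] is a product of polynomials in the coordinates. *)
Definition bounded_lip (g : V -> R) := exists2 C, 0 <= C &
  (forall x, S x -> `|g x| <= C) /\
  (forall x y, S x -> S y -> `|g x - g y| <= C * enorm (x - y)).

Lemma bounded_lip_cst c : bounded_lip (fun=> c).
Proof.
exists `|c| => //; split => // x y _ _.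
by rewrite subrr normr0 mulr_ge0// enorm_ge0.
Qed.

Lemma bounded_lipD g g' : bounded_lip g -> bounded_lip g' ->
  bounded_lip (fun x => g x + g' x).
Proof.
move=> [C C0 [b h]] [C' C'0 [b' h']]; exists (C + C'); first exact: addr_ge0.
split=> [x Sx|x y Sx Sy].
  by apply: le_trans (ler_normD _ _) _; rewrite lerD// (b, b').
rewrite opprD addrACA mulrDl; apply: le_trans (ler_normD _ _) _.
by rewrite lerD// (h, h').
Qed.

Lemma bounded_lipM g g' : bounded_lip g -> bounded_lip g' ->
  bounded_lip (fun x => g x * g' x).
Proof.
move=> [C C0 [b h]] [C' C'0 [b' h']]; exists (C * C' + C * C').
  by rewrite addr_ge0// mulr_ge0.
have CC : 0 <= C * C' by exact: mulr_ge0.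
split=> [x Sx|x y Sx Sy].
  rewrite normrM; apply: (@le_trans _ _ (C * C')); last by rewrite lerDl.
  by rewrite ler_pM// (b, b').
have -> : g x * g' x - g y * g' y = g x * (g' x - g' y) + (g x - g y) * g' y by ring.
rewrite [leRHS]mulrDl; apply: le_trans (ler_normD _ _) _; rewrite !normrM; apply: lerD.
  rewrite -mulrA; apply: ler_pM => //; [exact: b|exact: h'].
rewrite (mulrC C) -mulrA mulrC; apply: ler_pM => //; [exact: b'|exact: h].
Qed.

Lemma bounded_lip_prod (I : Type) (s : seq I) (g : I -> V -> R) :
  (forall i, bounded_lip (g i)) -> bounded_lip (fun x => \prod_(i <- s) g i x).
Proof.
move=> hg; elim: s => [|i s IH].
  by under eq_fun do rewrite big_nil; exact: bounded_lip_cst.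
by under eq_fun do rewrite big_cons; exact: bounded_lipM.
Qed.

Lemma bounded_lip_horner (p : {poly R}) g : bounded_lip g ->
  bounded_lip (fun x => p.[g x]).
Proof.
move=> hg; elim/poly_ind: p => [|p c IH].
  by under eq_fun do rewrite horner0; exact: bounded_lip_cst.
under eq_fun do rewrite hornerMXaddC.
by apply: bounded_lipD; [exact: bounded_lipM|exact: bounded_lip_cst].
Qed.

End BoundedLipschitz.

Section Interpolant.
Context {R : realType} {d : nat}.
Notation V := 'rV[R]_d.

Lemma lag_bounded_lip l (j : gindex d l) (m : R) :
  bounded_lip (cube (0 : V) m) (lag j).
Proof.
apply: bounded_lip_prod => k; apply: bounded_lip_horner.
exists (Num.max m 1); first by rewrite le_max ler01 orbT.
split=> [x /(_ k)|x y _ _].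
  by rewrite mxE sub0r add0r -ler_norml le_max => ->.
have -> : x 0 k - y 0 k = (x - y) 0 k by rewrite !mxE.
apply: le_trans (coord_le_enorm _ k) _.
by rewrite ler_peMl ?enorm_ge0// le_max lexx orbT.
Qed.

Lemma lag_uniform_bounds l (m : R) : exists2 C : R, 0 <= C &
  (forall (j : gindex d l) (x : V), cube 0 m x -> `|lag j x| <= C) /\
  (forall (j : gindex d l) (x y : V), cube 0 m x -> cube 0 m y ->
    `|lag j x - lag j y| <= C * enorm (x - y)).
Proof.
have /choice[C hC] (j : gindex d l) : exists C, 0 <= C /\
  ((forall x : V, cube 0 m x -> `|lag j x| <= C) /\
  (forall x y : V, cube 0 m x -> cube 0 m y ->
    `|lag j x - lag j y| <= C * enorm (x - y))).
  by have [C C0 h] := lag_bounded_lip j m; exists C.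
have Cj j : C j <= \sum_j C j.
  by rewrite (bigD1 j)//= lerDl sumr_ge0// => k _; have [] := hC k.
exists (\sum_j C j); first by apply: sumr_ge0 => j _; have [] := hC j.
split=> [j x mx|j x y mx my]; have [C0 [h1 h2]] := hC j.
  exact: le_trans (h1 _ mx) (Cj j).
apply: le_trans (h2 _ _ mx my) _.
by apply: ler_wpM2r (Cj j); exact: enorm_ge0.
Qed.

(** The constant is chosen before the centre a and the step h, since a will be random and h will
    tend to 0; the factor 1 / h in the second bound comes from the rescaling. *)
Lemma poly_fun_bounds r l : (r <= l.*2)%N -> exists2 C : R, 0 <= C &
  forall (th th' : {ffun mindex d r -> R}) (a : V) (h E : R), 0 < h ->
  (forall j : gindex d l, `|poly_fun th (grid_point a h j)
     - poly_fun th' (grid_point a h j)| <= E) ->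
  (forall x, cube a (l%:R * h) x -> `|poly_fun th x - poly_fun th' x| <= C * E) /\
  (forall x y, cube a (l%:R * h) x -> cube a (l%:R * h) y ->
    `|(poly_fun th x - poly_fun th' x) - (poly_fun th y - poly_fun th' y)|
      <= C * (E / h) * enorm (x - y)).
Proof.
move=> rl; have [C C0 [hb hl]] := lag_uniform_bounds l l%:R.
exists (#|gindex d l|%:R * C); first by rewrite mulr_ge0.
move=> th th' a h E h0 hE.
have hn0 := lt0r_neq0 h0.
pose e (j : gindex d l) := poly_fun th (grid_point a h j) - poly_fun th' (grid_point a h j).
have HE x : poly_fun th x - poly_fun th' x =
    \sum_(j : gindex d l) lag j (h^-1 *: (x - a)) * e j.
  rewrite (poly_fun_lagrange th a _ hn0 rl) (poly_fun_lagrange th' a _ hn0 rl).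
  by rewrite -sumrB; apply: eq_bigr => j _; rewrite -mulrBr.
have cu x : cube a (l%:R * h) x -> cube 0 l%:R (h^-1 *: (x - a)).
  move=> xc k; rewrite !mxE sub0r add0r -ler_norml normrM normfV (gtr0_norm h0).
  rewrite mulrC ler_pdivrMr// ler_norml; have /andP[? ?] := xc k.
  by apply/andP; split; lra.
have sumE (F : gindex d l -> R) (K : R) : (forall j, `|F j| <= K * E) ->
    `|\sum_j F j| <= #|gindex d l|%:R * K * E.
  move=> hF; apply: le_trans (ler_norm_sum _ _ _) _.
  apply: le_trans (ler_sum _ (fun j _ => hF j)) _.
  by rewrite sumr_const -[leLHS]mulr_natl mulrA.
split=> [x /cu xc|x y /cu xc /cu yc].
  rewrite HE; apply: sumE => j; rewrite normrM.
  by apply: ler_pM => //; [exact: hb|exact: hE].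
rewrite !HE -sumrB.
have -> : #|gindex d l|%:R * C * (E / h) * enorm (x - y) =
  #|gindex d l|%:R * (C * (h^-1 * enorm (x - y))) * E by ring.
apply: sumE => j; rewrite -mulrBl normrM; apply: ler_pM => //; last exact: hE.
apply: le_trans (hl _ _ _ xc yc) _; rewrite -scalerBr.
rewrite opprB addrA subrK enormZ normfV (gtr0_norm h0)//.
Qed.

(** In Euclidean norm over the grid, the comparison of residuals says |H - e| <= |e|, where H is the
    difference of the polynomials and e the averaged residual; each |H j| is then at most twice the
    sum E, which dominates the Euclidean norm of e. *)
Lemma fit_error r l q (th th' : {ffun mindex d r -> R}) (f : V -> R)
    (a : V) (h : R) (zeta : gindex d l * 'I_q -> R)
    (b := fun j => f (grid_point a h j) - poly_fun th' (grid_point a h j))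
    (eta := fun j => q%:R^-1 * \sum_s zeta (j, s)) :
  (0 < q)%N ->
  (rss (fun k : gindex d l * 'I_q => grid_point a h k.1)
       (fun k : gindex d l * 'I_q => f (grid_point a h k.1) + zeta k) th <=
   rss (fun k : gindex d l * 'I_q => grid_point a h k.1)
       (fun k : gindex d l * 'I_q => f (grid_point a h k.1) + zeta k) th') ->
  forall j : gindex d l, `|poly_fun th (grid_point a h j) - poly_fun th' (grid_point a h j)|
    <= 2 * \sum_j (`|b j| + `|eta j|).
Proof.
move=> q0 hmin.
pose H (j : gindex d l) := poly_fun th (grid_point a h j) - poly_fun th' (grid_point a h j).
pose e (j : gindex d l) := b j + eta j.
have qR : q%:R != 0 :> R by rewrite pnatr_eq0 -lt0n.
have qP : 0 < q%:R :> R by rewrite ltr0n.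
(* The variation among replicates at one point is the same for both polynomials and cancels, leaving
   q times the difference for the averages. *)
have H2 : \sum_j (H j - e j) ^+ 2 <= \sum_j e j ^+ 2.
  rewrite -subr_ge0 -(pmulr_rge0 _ qP).
  move: hmin; rewrite -subr_ge0 /rss.
  congr (0 <= _); rewrite -!sumrB mulr_sumr.
  pose F j s :=
    (f (grid_point a h j) + zeta (j, s) - poly_fun th' (grid_point a h j)) ^+ 2 -
    (f (grid_point a h j) + zeta (j, s) - poly_fun th (grid_point a h j)) ^+ 2.
  rewrite [LHS](eq_bigr (fun k => F k.1 k.2)); last by case.
  rewrite -(pair_bigA _ F)/=.
  apply: eq_bigr => j _.
  have -> : q%:R * (e j ^+ 2 - (H j - e j) ^+ 2) =
    \sum_(s < q) (2 * H j * b j - H j ^+ 2) + 2 * H j * \sum_s zeta (j, s).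
    rewrite sumr_const card_ord -[X in _ = X + _]mulr_natl /e /eta; field; exact: qR.
  rewrite mulr_sumr -big_split/=; apply: eq_bigr => s _; rewrite /F /H /b; ring.
pose E := \sum_j (`|b j| + `|eta j|).
have eE j : `|e j| <= E.
  rewrite /E (bigD1 j)//=; apply: ler_wpDr; last exact: ler_normD.
  by apply: sumr_ge0 => k _; rewrite addr_ge0.
have E0 : 0 <= E by apply: sumr_ge0 => j _; rewrite addr_ge0.
have e2 : \sum_j e j ^+ 2 <= E ^+ 2.
  rewrite [leRHS]expr2 {1}/E mulr_suml; apply: ler_sum => j _.
  by rewrite -real_normK ?num_real// expr2 ler_pM// ler_normD.
move=> j; rewrite -/(H j) -/E.
have : `|H j - e j| <= E.
  rewrite -(@ler_pXn2r _ 2)// ?nnegrE// real_normK ?num_real//.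
  apply: le_trans e2; apply: le_trans H2.
  by rewrite (bigD1 j)//= lerDl sumr_ge0// => k _; exact: sqr_ge0.
have := eE j; rewrite !ler_norml => /andP[? ?] /andP[? ?]; apply/andP; split; lra.
Qed.

End Interpolant.

(** * Pathwise error bound for the estimator *)

Section Deterministic.
Context {R : realType} {d : nat}.
Notation V := 'rV[R]_d.
Variables (D : set V) (f : V -> R) (eps alpha L : R) (mu : V).
Hypothesis d_gt0 : (0 < d)%N.
Hypothesis eps_gt0 : 0 < eps.
Hypothesis alpha_gt2 : 2 < alpha.
Hypothesis L_gt0 : 0 < L.
Let A := enlarge D eps.
Hypothesis f_holder : holder_class alpha L A f.
Hypothesis mu_int : interior D mu.
Hypothesis mu_max : forall y, D y -> f y <= f mu.
Hypothesis hess_neg : lambda_max (hessian A f mu) < 0.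
Let r := holder_order alpha.
Let l := uphalf r.

Lemma double_uphalf_ge n : (n <= (uphalf n).*2)%N.
Proof. by rewrite uphalf_half doubleD -{1}(odd_double_half n) leq_add2r; case: odd. Qed.

Lemma uphalf_holder_order_gt0 : (0 < l)%N.
Proof. by have := holder_order_ge2 alpha_gt2; rewrite /l /r; case: (holder_order alpha). Qed.

Lemma two_stage_error : exists C h0 : R, [/\ 0 < C, 0 < h0 &
  forall (a : V) (h : R) q (zeta : gindex d l * 'I_q -> R)
    (th : {ffun mindex d r -> R}) (muh : V)
    (S : R := \sum_j `|q%:R^-1 * \sum_s zeta (j, s)|),
  0 < h < h0 -> (0 < q)%N -> enorm (a - mu) <= h ->
  (forall th' : {ffun mindex d r -> R},
   rss (fun k : gindex d l * 'I_q => grid_point a h k.1)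
       (fun k : gindex d l * 'I_q => f (grid_point a h k.1) + zeta k) th <=
   rss (fun k : gindex d l * 'I_q => grid_point a h k.1)
       (fun k : gindex d l * 'I_q => f (grid_point a h k.1) + zeta k) th') ->
  cube a (l%:R * h) muh ->
  (forall x, cube a (l%:R * h) x -> poly_fun th x <= poly_fun th muh) ->
  enorm (muh - mu) <= C * (S / h + h `^ (alpha - 1)) /\
  `|poly_fun th muh - f mu| <= C * (S + h `^ alpha)].
Proof.
have [c [rho [c0 rho0 hpeak]]] := taylor_quadratic_peak d_gt0 eps_gt0 alpha_gt2
  L_gt0 f_holder mu_int mu_max hess_neg.
have l0 := uphalf_holder_order_gt0.
have l1 : 1 <= l%:R :> R by rewrite ler1n.
have [th' thE] := taylor_poly_fun r A f mu.
have [B B0 hB] := @poly_fun_bounds R d r l (double_uphalf_ge r).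
have /nbhs_ballP[rhoD rhoD0 hD] := mu_int.
(* A coordinate of a point of the cube is within l h of that of a, hence within (l + 1) h of that of
   mu; d converts to the Euclidean norm. *)
pose K : R := d%:R * (l%:R + 1).
have K0 : 0 < K by rewrite mulr_gt0 ?ltr0n// ltr_wpDl.
pose N : R := #|gindex d l|%:R.
(* Q bounds both the coefficient 1 of the noise and the coefficient of h^alpha in the total bias
   over the N grid points. *)
pose Q : R := Num.max 1 (N * (L * K `^ alpha)).
have Q1 : 1 <= Q by rewrite le_max lexx.
have NQ : N * (L * K `^ alpha) <= Q by rewrite le_max lexx orbT.
(* One constant for both conclusions: the location needs division by c, the value does not. B + 1
   makes it positive even if B = 0. *)
pose C := (B + 1) * 2 * Q / Num.min c 1.
have m0 : 0 < Num.min c 1 by rewrite lt_min c0 ltr01.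
have C0 : 0 < C by rewrite divr_gt0// !mulr_gt0//; lra.
exists C, (Num.min rho rhoD / K); split => //.
  by rewrite divr_gt0// lt_min rho0.
move=> a h q zeta th muh S /andP[h0 hh0] q0 amu hmin muhc muhmax.
move: hh0; rewrite ltr_pdivlMr// mulrC lt_min => /andP[Krho KrhoD].
have coordK (x : V) (t : 'I_d -> R) : (forall k, `|t k| <= l%:R * h) ->
    (forall k, x 0 k = a 0 k + t k) -> enorm (x - mu) <= K * h.
  move=> th0 xt; rewrite /K -mulrA; apply: enorm_le_coord => k.
  have := le_trans (coord_le_enorm (a - mu) k) amu.
  have := th0 k; rewrite !mxE xt !ler_norml => /andP[? ?] /andP[? ?].
  by apply/andP; split; lra.
have cubeK (x : V) : cube a (l%:R * h) x -> enorm (x - mu) <= K * h.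
  move=> xc; apply: (coordK _ (fun k => x 0 k - a 0 k)) => k; last by rewrite subrKC.
  by have /andP[? ?] := xc k; rewrite ler_norml; apply/andP; split; lra.
have gridK (j : gindex d l) : enorm (grid_point a h j - mu) <= K * h.
  apply: (coordK _ (fun k => ((j k)%:R - l%:R) * h)) => k; last by rewrite mxE.
  rewrite normrM (gtr0_norm h0) ler_wpM2r ?(ltW h0)// ler_norml.
  have : (j k)%:R <= l.*2%:R :> R by rewrite ler_nat -ltnS ltn_ord.
  have -> : l.*2%:R = l%:R + l%:R :> R by rewrite -addnn natrD.
  move=> ?.
  have : 0 <= (j k)%:R :> R by [].
  by move=> ?; apply/andP; split; lra.
(* Since l >= 1, an error at most h in the centre keeps mu in the cube, so [muh] can be compared
   with mu. *)
have muc : cube a (l%:R * h) mu.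
  move=> k; have := le_trans (coord_le_enorm (a - mu) k) amu.
  have lh : h <= l%:R * h by rewrite ler_peMl// ltW.
  by rewrite !mxE ler_norml => /andP[? ?]; apply/andP; split; lra.
have bias (j : gindex d l) : `|f (grid_point a h j) - poly_fun th' (grid_point a h j)|
    <= L * K `^ alpha * h `^ alpha.
  rewrite -thE.
  have Dj : D (grid_point a h j).
    apply: hD; rewrite -ball_normE/= distrC.
    by apply: le_lt_trans (norm_le_enorm _) _; apply: le_lt_trans (gridK j) _.
  have := f_holder.2 _ mu (sub_enlarge eps_gt0 Dj)
    (enlarge_center eps_gt0 mu_int).
  move=> hh; apply: le_trans hh _.
  rewrite -mulrA ler_wpM2l ?(ltW L_gt0)// -powRM ?(ltW K0) ?(ltW h0)//.
  apply: ge0_ler_powR; rewrite ?nnegrE ?enorm_ge0//.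
  - by apply: ltW; apply: lt_trans alpha_gt2.
  - by rewrite mulr_ge0// ltW.
pose E := S + h `^ alpha.
have S0 : 0 <= S by apply: sumr_ge0.
have E0 : 0 <= E by rewrite addr_ge0// powR_ge0.
have gridE (j : gindex d l) :
    `|poly_fun th (grid_point a h j) - poly_fun th' (grid_point a h j)| <= 2 * Q * E.
  apply: le_trans (fit_error q0 (hmin th') j) _.
  rewrite -mulrA ler_wpM2l// big_split/= -/S /E mulrDr addrC; apply: lerD.
    by rewrite ler_peMl.
  apply: le_trans (ler_sum _ (fun j _ => bias j)) _.
  rewrite sumr_const -[leLHS]mulr_natl -/N mulrA.
  by rewrite ler_wpM2r// powR_ge0.
have [hb hl] := hB th th' a h _ h0 gridE.
pose H (x : V) := poly_fun th x - poly_fun th' x.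
have Hb (x : V) : cube a (l%:R * h) x -> `|H x| <= C * E.
  move=> xc; apply: le_trans (hb x xc) _.
  rewrite mulrA ler_wpM2r// /C.
  rewrite ler_pdivlMr//.
  have : Num.min c 1 <= 1 by rewrite ge_min lexx orbT.
  have : 0 <= B * (2 * Q) by rewrite !mulr_ge0//; lra.
  move=> p0 p1; apply: (@le_trans _ _ (B * (2 * Q))); first by rewrite ler_piMr.
  lra.
have pmu : poly_fun th' mu = f mu.
  by rewrite -thE; exact: (taylor_at_center eps_gt0 alpha_gt2 f_holder mu_int).
have pk := hpeak muh (le_lt_trans (cubeK _ muhc) Krho).
rewrite !thE in pk.
have max1 := muhmax _ muc.
rewrite pmu in pk.
split; last first.
  (* Below, [poly_fun th muh] is at least the fit at mu; above, p(muh) <= p(mu). Both sides cost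
     only the uniform bound on H, so no factor 1 / h enters the value. *)
  rewrite -/E; have := Hb _ muhc; have := Hb _ muc; rewrite /H pmu !ler_norml.
  have : 0 <= c * enorm (muh - mu) ^+ 2 by rewrite mulr_ge0 ?sqr_ge0// ltW.
  move=> ? /andP[? ?] /andP[? ?]; apply/andP; split; lra.
have := hl _ _ muhc muc.
set n := enorm (muh - mu) in pk *.
have n0 : 0 <= n by exact: enorm_ge0.
have Eh : E / h = S / h + h `^ (alpha - 1).
  rewrite /E mulrDl; congr (_ + _).
  rewrite -(@mulr_powRB1 _ h alpha) ?(ltW h0)//; last by apply: lt_trans alpha_gt2.
  by rewrite mulrAC mulfV ?mul1r// lt0r_neq0.
move=> /(le_trans (ler_norm _)) lip.
have key : c * n ^+ 2 <= B * (2 * Q * E / h) * n by lra.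
have [->|nn] := eqVneq n 0.
  by rewrite mulr_ge0 ?(ltW C0)// addr_ge0 ?powR_ge0// divr_ge0// ltW.
have np : 0 < n by rewrite lt_neqAle eq_sym nn.
have key2 : c * n <= B * (2 * Q * E / h).
  rewrite -(ler_pM2r np); apply: le_trans key.
  by rewrite expr2 mulrA.
rewrite -Eh /C mulrAC ler_pdivlMr//.
have Eh0 : 0 <= E / h by rewrite divr_ge0// ltW.
apply: (@le_trans _ _ (c * n)).
  by rewrite mulrC ler_wpM2r// ge_min lexx.
apply: le_trans key2 _.
have -> : B * (2 * Q * E / h) = B * 2 * Q * (E / h) by ring.
rewrite ler_wpM2r//; lra.
Qed.

End Deterministic.

(** * Measurability *)

Section Measurability.
Context {R : realType} {d : nat} {disp : measure_display} {T : measurableType disp}.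
Notation V := 'rV[R]_d.
Implicit Types (g : T -> V).

(** Half-open lattice boxes of side 1 / (m + 1): there are countably many, their preimages are
    measurable coordinate by coordinate, and every open set is a union of them. *)
Definition mesh_cell (m : nat) (t : {ffun 'I_d -> int}) : set V :=
  [set x | forall k, (t k)%:~R <= m.+1%:R * x 0 k < (t k + 1)%:~R].

Lemma measurable_preimage_mesh_cell g m t : measurable_vec g ->
  measurable (g @^-1` mesh_cell m t).
Proof.
move=> mg.
have -> : g @^-1` mesh_cell m t = \bigcap_(k in [set: 'I_d])
    ((fun w => m.+1%:R * g w 0 k) @^-1` `[(t k)%:~R, (t k + 1)%:~R[%classic).
  by apply/seteqP; split => w /= h k; have := h k; rewrite /= in_itv/=; auto.
apply: fin_bigcap_measurable => // k _.
rewrite -[X in measurable X]setTI.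
have mk : measurable_fun [set: T] (fun w => m.+1%:R * g w 0 k).
  by apply: measurable_funM; [exact: measurable_cst|exact: mg].
exact: mk.
Qed.

Lemma open_mesh_cell_cover (U : set V) x : open U -> U x ->
  exists m t, mesh_cell m t x /\ mesh_cell m t `<=` U.
Proof.
rewrite openE => /[apply] /nbhs_ballP[e e0 eU].
have [m me] : exists m : nat, m.+1%:R^-1 < e.
  have [m _ hm] := near_infty_natSinv_lt (PosNum e0).
  by exists m; exact: (hm m (leqnn m)).
have m0 : 0 < m.+1%:R :> R by rewrite ltr0n.
exists m, [ffun k => Num.floor (m.+1%:R * x 0 k)].
split=> [k|y hy]; first by rewrite ffunE; exact: floor_itv.
apply: eU; rewrite -ball_normE /=; apply: le_lt_trans me.
apply: norm_le_coord => [|k]; first by rewrite invr_ge0 ltW.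
have := hy k; rewrite ffunE !mxE => /andP[h1 h2].
have /andP[h3 h4] := floor_itv (m.+1%:R * x 0 k).
rewrite intrD in h2 h4.
rewrite -(ler_pM2l m0) mulfV ?lt0r_neq0//.
rewrite -[X in X * _]gtr0_norm// -normrM ler_norml mulrBr.
by apply/andP; split; lra.
Qed.

Lemma measurable_preimage_open g (U : set V) : measurable_vec g -> open U ->
  measurable (g @^-1` U).
Proof.
move=> mg oU.
pose F (mt : nat * {ffun 'I_d -> int}) : set T :=
  if `[< mesh_cell mt.1 mt.2 `<=` U >] then g @^-1` mesh_cell mt.1 mt.2 else set0.
have -> : g @^-1` U = \bigcup_mt F mt.
  apply/seteqP; split=> [w /= /(open_mesh_cell_cover oU)[m [t [mtw mtU]]]|w [mt _]].
    by exists (m, t) => //; rewrite /F asboolT.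
  by rewrite /F; case: asboolP => // h /h.
apply: countable_bigcupT_measurable; first exact: countableP.
move=> mt; rewrite /F; case: ifP => _ //.
exact: measurable_preimage_mesh_cell.
Qed.

(** Meant for f at the random grid points: f is controlled only on the enlargement of D, so
    continuity is asked on an open set containing all values of g. *)
Lemma measurable_fun_comp_continuous g (U : set V) (f : V -> R) :
  measurable_vec g -> open U -> (forall x, U x -> {for x, continuous f}) ->
  (forall w, U (g w)) -> measurable_fun [set: T] (f \o g).
Proof.
move=> mg oU fU gU.
apply: (measurability _ (RGenOInfty.measurableE R)).
move=> _ [_ [c ->] <-]; rewrite setTI.
have -> : (f \o g) @^-1` `]c, +oo[ = g @^-1` (U `&` f @^-1` `]c, +oo[).
  by apply/seteqP; split => w /=; [split|case].
apply: measurable_preimage_open => //.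
rewrite openE => x [Ux fx]; apply: filterI.
  exact: open_nbhs_nbhs.
apply: (fU _ Ux); apply: open_nbhs_nbhs; split => //.
Qed.

Lemma measurable_fun_horner (p : {poly R}) (h : T -> R) :
  measurable_fun [set: T] h -> measurable_fun [set: T] (fun w => p.[h w]).
Proof.
move=> mh; elim/poly_ind: p => [|p c IH].
  by under eq_fun do rewrite horner0; exact: measurable_cst.
under eq_fun do rewrite hornerMXaddC.
by apply: measurable_funD; [exact: measurable_funM|exact: measurable_cst].
Qed.

Lemma measurable_fun_lag l (j : gindex d l) g : measurable_vec g ->
  measurable_fun [set: T] (fun w => lag j (g w)).
Proof.
by move=> mg; apply: measurable_prod => k _; exact: measurable_fun_horner.
Qed.

Lemma measurable_fun_enorm g : measurable_vec g ->
  measurable_fun [set: T] (fun w => enorm (g w)).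
Proof.
move=> mg; apply: (measurableT_comp (f := @Num.sqrt R)).
  apply: continuous_measurable_fun; exact: sqrt_continuous.
by apply: measurable_sum => k; apply: measurable_funX; exact: mg.
Qed.

Lemma measurable_vecB g g' : measurable_vec g -> measurable_vec g' ->
  measurable_vec (fun w => g w - g' w).
Proof.
move=> mg mg' k; under eq_fun do rewrite !mxE.
by apply: measurable_funB; [exact: mg|exact: mg'].
Qed.

Lemma measurable_vecZ g (c : R) : measurable_vec g ->
  measurable_vec (fun w => c *: g w).
Proof.
move=> mg k; under eq_fun do rewrite !mxE.
by apply: measurable_funM; [exact: measurable_cst|exact: mg].
Qed.

Lemma measurable_vec_grid l (j : gindex d l) g (h : R) : measurable_vec g ->
  measurable_vec (fun w => grid_point (g w) h j).
Proof.
move=> mg k; under eq_fun do rewrite !mxE.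
by apply: measurable_funD; [exact: mg|exact: measurable_cst].
Qed.

End Measurability.

(** * Linearity of the fitted values in the observations *)

Section Fit.
Context {R : realType} {d : nat}.
Notation V := 'rV[R]_d.

Lemma grid_point_affine l (j : gindex d l) (a : V) h :
  grid_point a h j = h *: grid_point 0 1 j + a.
Proof. by apply/rowP => k; rewrite !mxE add0r mulr1 mulrC addrC. Qed.

(** [Pi] precedes a in the quantifiers: it stays deterministic when the centre is random, so the
    fitted values are measurable whatever minimizer is selected. *)
Lemma fitted_values_linear r l q :
  exists Pi : gindex d l * 'I_q -> gindex d l * 'I_q -> R,
  forall (a : V) h (Y : gindex d l * 'I_q -> R) (th : {ffun mindex d r -> R}), h != 0 ->
  (forall th' : {ffun mindex d r -> R},
    rss (fun k : gindex d l * 'I_q => grid_point a h k.1) Y th <=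
    rss (fun k : gindex d l * 'I_q => grid_point a h k.1) Y th') ->
  forall k, poly_fun th (grid_point a h k.1) = \sum_k' Pi k k' * Y k'.
Proof.
have [Pi hPi] := lsq_fit (fun (i : mindex d r) (k : gindex d l * 'I_q) =>
  mono i (grid_point 0 1 k.1 : V)).
exists Pi => a h Y th h0 hmin k.
(* In the coordinates (x - a) / h the grid, hence the hat matrix, is fixed. *)
have [q0 hq0] := poly_fun_affine th a h.
rewrite grid_point_affine hq0; apply: (hPi Y q0) => q'.
have [th' hth'] := poly_fun_affine [ffun i => q' i] (- (h^-1 *: a)) h^-1.
have := hmin th'; rewrite /rss.
congr (_ <= _); apply: eq_bigr => k' _; rewrite grid_point_affine ?hq0//.
rewrite -hth' scalerDr scalerA mulVf// scale1r addrK.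
by congr ((_ - _) ^+ 2); apply: eq_bigr => i _; rewrite ffunE.
Qed.

End Fit.

(** * Averages of independent errors *)

Section LevelSets.
Context {R : realType} {disp : measure_display} {T : measurableType disp}.

Lemma measurable_set_gt (h : T -> R) c : measurable_fun [set: T] h ->
  measurable [set w | c < h w].
Proof.
move=> /(_ measurableT `]c, +oo[%classic (measurable_itv _)); rewrite setTI.
by congr measurable; apply/seteqP; split => w; rewrite /= in_itv/= andbT.
Qed.

Lemma measurable_set_ge (h : T -> R) c : measurable_fun [set: T] h ->
  measurable [set w | c <= h w].
Proof.
move=> /(_ measurableT `[c, +oo[%classic (measurable_itv _)); rewrite setTI.
by congr measurable; apply/seteqP; split => w; rewrite /= in_itv/= andbT.
Qed.

End LevelSets.

Section IndependentProduct.
Context {R : realType} {disp : measure_display} {T : measurableType disp}.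
Variable P : probability T R.
Local Open Scope ereal_scope.

(** The integral is the difference of those of the positive and negative parts, and is infinite as
    soon as one of them is; a finite value thus forces integrability. *)
Lemma centered_integrable (X : {RV P >-> R}) : 'E_P[X] = 0 ->
  (X : T -> R) \in Lfun P 1.
Proof.
rewrite unlock => EX; apply/Lfun1_integrable/integrableP; split.
  exact/measurable_EFinP.
by rewrite integral_fin_num_abs//= EX.
Qed.

Lemma centered_variance (X : {RV P >-> R}) : 'E_P[X] = 0 ->
  'V_P[X] = 'E_P[X \* X].
Proof.
move=> EX; rewrite /variance unlock EX/=; congr expectation.
apply/funext => w.
by transitivity ((X w - 0) * (X w - 0))%R; last rewrite subr0.
Qed.

Lemma finite_second_moment (X : {RV P >-> R}) (s : R) : 'E_P[X \* X] = s%:E ->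
  P.-integrable [set: T] (EFin \o (X \* X)%R).
Proof.
rewrite unlock => EX; apply/integrableP; split.
  by apply/measurable_EFinP; exact: measurable_funM.
rewrite integral_fin_num_abs//= ?EX//; exact: measurable_funM.
Qed.

Lemma integrable_mul (X Y : {RV P >-> R}) (s t : R) : 'E_P[X \* X] = s%:E ->
  'E_P[Y \* Y] = t%:E -> (X \* Y)%R \in Lfun P 1.
Proof.
move=> /finite_second_moment iX /finite_second_moment iY.
apply/Lfun1_integrable.
apply: (le_integrable _ _ _ (integrableD _ iX iY)) => //=.
  by apply/measurable_EFinP; exact: measurable_funM.
move=> w _; rewrite lee_fin/= normrM.
rewrite [leRHS]ger0_norm ?addr_ge0 -?expr2 ?sqr_ge0//.
rewrite -(real_normK (num_real (X w))) -(real_normK (num_real (Y w))).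
by have := sqr_ge0 (`|X w| - `|Y w|)%R; have := normr_ge0 (X w); have := normr_ge0 (Y w); nra.
Qed.

(** By uniqueness of the product measure the joint law is the product of the marginals; in Fubini's
    theorem the inner integral is x times the mean of Y, hence 0. *)
Lemma expectation_indep_mul (X Y : {RV P >-> R}) :
  (forall A B, measurable A -> measurable B ->
    P (X @^-1` A `&` Y @^-1` B) = P (X @^-1` A) * P (Y @^-1` B)) ->
  (X \* Y)%R \in Lfun P 1 -> 'E_P[Y] = 0 -> 'E_P[X \* Y] = 0.
Proof.
move=> XY iXY EY.
pose phi w := (X w, Y w).
have mphi : measurable_fun [set: T] phi by exact: measurable_fun_pair.
pose m' := pushforward P phi.
pose F (z : R * R) : \bar R := (z.1 * z.2)%:E.
have mF : measurable_fun [set: R * R] F.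
  apply/measurable_EFinP.
  by apply: measurable_funM; [exact: measurable_fst|exact: measurable_snd].
have iF : P.-integrable [set: T] (F \o phi) by move/Lfun1_integrable: iXY.
have iF' : (pushforward P phi).-integrable [set: R * R] F.
  exact: integrable_pushforward.
have mE A : measurable A -> (distribution P X \x distribution P Y) A = pushforward P phi A.
  move=> mA.
  have := @product_measure_unique _ _ _ _ _ (distribution P X) (distribution P Y)
    (pushforward P phi).
  apply => // A' B' mA' mB'; rewrite /pushforward /distribution/= -XY//.
have iF'' : (distribution P X \x distribution P Y).-integrable [set: R * R] F.
  apply/integrableP; split => //.
  move/integrableP: iF' => [_]; congr (_ < _).
  by apply: eq_measure_integral => A mA _; exact/esym/mE.
rewrite unlock.
transitivity (\int[pushforward P phi]_z F z).
  by rewrite integral_pushforward.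
rewrite (@eq_measure_integral _ _ _ _ (distribution P X \x distribution P Y)); last first.
  by move=> A mA _; exact/esym/mE.
rewrite -integral12_prod_meas1//.
rewrite integral0_eq// => x _; rewrite /fubini_F /F/=.
under eq_integral do rewrite EFinM.
have iY : P.-integrable [set: T] (EFin \o Y).
  by have /Lfun1_integrable := centered_integrable EY.
rewrite integralZl//; last first.
  exact: (integrable_pushforward _ _ iY).
rewrite (_ : integral _ _ _ = 0) ?mule0//.
rewrite integral_distribution//.
by move: EY; rewrite unlock.
Qed.

Lemma expectation_sqr_sum (I : finType) (X : I -> {RV P >-> R}) (s : R) :
  (forall i, 'E_P[X i] = 0) -> (forall i, 'V_P[X i] = s%:E) ->
  (forall i j A B, i != j -> measurable A -> measurable B ->
    P (X i @^-1` A `&` X j @^-1` B) = P (X i @^-1` A) * P (X j @^-1` B)) ->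
  \int[P]_w (((\sum_i X i w) ^+ 2)%R)%:E = (#|I|%:R * s)%:E.
Proof.
move=> EX VX indep.
have X2 i : 'E_P[X i \* X i] = s%:E by rewrite -centered_variance.
have iXX i j : (X i \* X j)%R \in Lfun P 1 by exact: integrable_mul.
have EXX i j : 'E_P[X i \* X j] = (if i == j then s else 0)%:E.
  case: eqVneq => [<-|ij]; first exact: X2.
  by apply: expectation_indep_mul => // A B mA mB; exact: indep.
transitivity (\int[P]_w \sum_(ij : I * I) ((X ij.1 \* X ij.2)%R w)%:E).
  apply: eq_integral => w _; rewrite sumEFin; congr EFin.
  rewrite expr2 mulr_suml -(pair_bigA _ (fun i j => X i w * X j w)%R)/=.
  by apply: eq_bigr => i _; rewrite mulr_sumr.
rewrite integral_sum//; last by move=> [i j]; apply/Lfun1_integrable; exact: iXX.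
transitivity (\sum_(ij : I * I) (if ij.1 == ij.2 then s else 0)%:E).
  by apply: eq_bigr => -[i j] _; rewrite -EXX unlock.
rewrite sumEFin; congr EFin.
rewrite -(pair_bigA _ (fun i j => if i == j then s else 0)%R)/=.
under eq_bigr => i _.
  rewrite (bigD1 i)//= eqxx big1 ?addr0; last by move=> j /negPf; rewrite eq_sym => ->.
  over.
by rewrite sumr_const mulr_natl.
Qed.

Lemma sqr_sum_le (I : finType) (a : I -> R) :
  ((\sum_i `|a i|) ^+ 2 <= #|I|%:R * \sum_i a i ^+ 2)%R.
Proof.
have -> : (#|I|%:R * \sum_i a i ^+ 2 =
    \sum_i \sum_j ((a i ^+ 2 + a j ^+ 2) / 2))%R.
  under [RHS]eq_bigr do rewrite -mulr_suml big_split/= sumr_const -[X in (X + _)%R]mulr_natl.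
  rewrite -mulr_suml big_split/= -mulr_sumr sumr_const -[X in (_ + X)%R]mulr_natl.
  by field.
rewrite expr2 mulr_suml; apply: ler_sum => i _; rewrite mulr_sumr; apply: ler_sum => j _.
rewrite -(real_normK (num_real (a i))) -(real_normK (num_real (a j))).
rewrite ler_pdivlMr//.
have := sqr_ge0 (`|a i| - `|a j|)%R; nra.
Qed.

Lemma noise_tail (J : finType) (q : nat) (X : J * 'I_q -> {RV P >-> R}) (s t : R) :
  (0 < q)%N -> (0 < t)%R ->
  (forall i, 'E_P[X i] = 0) -> (forall i, 'V_P[X i] = s%:E) ->
  (forall i j A B, i != j -> measurable A -> measurable B ->
    P (X i @^-1` A `&` X j @^-1` B) = P (X i @^-1` A) * P (X j @^-1` B)) ->
  P [set w | (t < \sum_j `|q%:R^-1 * \sum_(r < q) X (j, r) w|)%R] <=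
    (#|J|%:R ^+ 2 * s / (t ^+ 2 * q%:R))%:E.
Proof.
move=> q0 t0 EX VX indep.
have qR : (0 < q%:R :> R)%R by rewrite ltr0n.
pose N : R := #|J|%:R.
pose c : R := (N / q%:R ^+ 2)%R.
(* By Cauchy-Schwarz Q dominates the square of the sum of absolute averages; its mean is (N / q^2) N
   q s = N^2 s / q, and Markov's inequality is applied to it at level t^2. *)
pose Q w : R := (c * \sum_j (\sum_(r < q) X (j, r) w) ^+ 2)%R.
have mQj j : measurable_fun [set: T] (fun w => (\sum_(r < q) X (j, r) w) ^+ 2)%R.
  by apply: measurable_funX; exact: measurable_sum.
have mQ : measurable_fun [set: T] Q.
  apply: measurable_funM; first exact: measurable_cst.
  by apply: measurable_sum.
have c0 : (0 <= c)%R by rewrite divr_ge0// exprn_ge0.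
have Q0 w : (0 <= Q w)%R.
  by rewrite mulr_ge0// sumr_ge0// => j _; exact: sqr_ge0.
have EQ : \int[P]_w (Q w)%:E = (N ^+ 2 * s / q%:R)%:E.
  rewrite /Q; under eq_integral do rewrite EFinM -sumEFin.
  rewrite ge0_integralZl//; last 2 first.
  - by apply: emeasurable_sum => j; apply/measurable_EFinP.
  - by move=> w _; apply: sume_ge0 => j _; rewrite lee_fin sqr_ge0.
  rewrite ge0_integral_sum//; last 2 first.
  - by move=> j; apply/measurable_EFinP.
  - by move=> j w _; rewrite lee_fin sqr_ge0.
  transitivity (c%:E * \sum_(j : J) (q%:R * s)%:E).
    congr (_ * _); apply: eq_bigr => j _.
    rewrite (@expectation_sqr_sum _ (fun r : 'I_q => X (j, r)) s)//.
      by rewrite card_ord.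
    move=> r r' A B rr'; apply: indep; apply: contra_neq rr' => -[->]//.
  rewrite sumEFin -EFinM sumr_const -[X in (_ * X)%R]mulr_natl -/N /c; congr EFin.
  by field; rewrite lt0r_neq0.
have mQE : measurable_fun [set: T] (EFin \o Q) by apply/measurable_EFinP.
have t2 : (0 < t ^+ 2)%R by rewrite exprn_gt0.
have step : (t ^+ 2)%:E * P [set w | (t ^+ 2 <= Q w)%R] <= (N ^+ 2 * s / q%:R)%:E.
  rewrite -EQ.
  pose QR : {RV P >-> R} := mfun_Sub (mem_set mQ).
  have := @markov _ _ _ P QR id (t ^+ 2)%R t2 (@measurable_id _ _ _) (fun r h => h)
    (fun x y _ _ => id).
  rewrite unlock /=.
  have -> : [set w | (t ^+ 2 <= Q w)%R] = [set w | (t ^+ 2)%:E <= (`|Q w|)%:E].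
    by apply: eq_set => w; rewrite lee_fin ger0_norm.
  by move/le_trans; apply; apply: ge0_le_integral => //=;
    do ?[by apply/measurable_EFinP; exact: measurableT_comp|
      move=> w _; rewrite lee_fin ger0_norm//].
have sub : [set w | (t < \sum_j `|q%:R^-1 * \sum_(r < q) X (j, r) w|)%R] `<=`
    [set w | (t ^+ 2 <= Q w)%R].
  move=> w /= tw; apply: (@le_trans _ _ ((\sum_j `|q%:R^-1 * \sum_(r < q) X (j, r) w|) ^+ 2)%R).
    by rewrite lerXn2r ?nnegrE ?(ltW t0) ?(ltW tw)// (le_trans _ (ltW tw))// ltW.
  apply: le_trans (sqr_sum_le _) _; rewrite /Q /c -/N -mulrA ler_wpM2l//.
  rewrite mulr_sumr; apply: ler_sum => j _.
  by rewrite exprMn exprVn.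
have mS : measurable [set w | (t < \sum_j `|q%:R^-1 * \sum_(r < q) X (j, r) w|)%R].
  apply: measurable_set_gt; apply: measurable_sum => j.
  apply: measurableT_comp => //; apply: measurable_funM; first exact: measurable_cst.
  exact: measurable_sum.
have mQt : measurable [set w | (t ^+ 2 <= Q w)%R] by exact: measurable_set_ge.
apply: (@le_trans _ _ (P [set w | (t ^+ 2 <= Q w)%R])).
  by apply: le_measure; rewrite ?inE.
rewrite -(lee_pmul2l (x := (t ^+ 2)%:E))// ?lte_fin//.
apply: le_trans step _; rewrite -EFinM lee_fin.
have -> : (t ^+ 2 * (#|J|%:R ^+ 2 * s / (t ^+ 2 * q%:R)) = N ^+ 2 * s / q%:R)%R.
  by rewrite -/N; field; rewrite !lt0r_neq0.
by [].
Qed.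

End IndependentProduct.

(** * Stochastic orders *)

Section RandomVariables.
Context {R : realType} {disp : measure_display} {T : measurableType disp}.
Variable P : probability T R.

(** [bigOp_add] asks for bundled random variables at every n, while measurability is known only for
    large n; elsewhere the value is the constant 0. *)
Definition rv_of (h : T -> R) : {RV P >-> R} :=
  if pselect (measurable_fun [set: T] h) is left mh then mfun_Sub (mem_set mh)
  else cst 0.

Lemma rv_ofE h : measurable_fun [set: T] h -> rv_of h = h :> (T -> R).
Proof. by rewrite /rv_of; case: pselect. Qed.

Definition tail (c : R) (h : T -> R) w := if c < `|h w| then h w else 0.

Lemma measurable_tail c h : measurable_fun [set: T] h ->
  measurable_fun [set: T] (tail c h).
Proof.
move=> mh; apply: measurable_fun_ifT => //.
apply: measurable_fun_ltr; first exact: measurable_cst.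
exact: measurableT_comp.
Qed.

Lemma independent_pair (I : finType) (X : I -> {RV P >-> R}) i j A B :
  mutually_independent X -> i != j -> measurable A -> measurable B ->
  (P (X i @^-1` A `&` X j @^-1` B) = P (X i @^-1` A) * P (X j @^-1` B))%E.
Proof.
move=> indep ij mA mB.
have := indep [set i; j]%SET (fun k => if k == i then A else B).
rewrite big_setU1 ?inE//= big_set1 eqxx eq_sym (negPf ij) => <-; last first.
  by move=> k; case: ifP.
congr (P _); apply/seteqP; split=> [w [Aw Bw] k /=|w h].
  by rewrite !inE => /orP[] /eqP ->; rewrite ?eqxx// eq_sym (negPf ij).
split; first by have := h i; rewrite /= !inE !eqxx; exact.
by have := h j; rewrite /= !inE eqxx orbT eq_sym (negPf ij); exact.
Qed.

End RandomVariables.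

Section BigOp.
Context {R : realType} {disp : measure_display} {T : nat -> measurableType disp}.
Variable P : forall n, probability (T n) R.

(* Z is split at the level 2 C b: above it, C b is at most |Z| / 2, so that
   |Z| <= 2 C W. *)
Lemma bigOp_add_of_bound (Z W : forall n, T n -> R) (a b : nat -> R) (C : R)
    (E : forall n, set (T n)) :
  0 < C -> (forall n, 0 <= a n) -> (forall n, 0 <= b n) ->
  (\forall n \near \oo, measurable_fun [set: T n] (Z n)) ->
  (\forall n \near \oo, measurable_fun [set: T n] (W n)) ->
  (\forall n \near \oo, measurable (E n)) ->
  (\forall n \near \oo, forall w, E n w -> `|Z n w| <= C * (W n w + b n)) ->
  (forall e : R, 0 < e -> \forall n \near \oo, (P n (~` E n) <= e%:E)%E) ->
  (forall e : R, 0 < e -> exists2 K : R, 0 < K &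
    \forall n \near \oo, (P n [set w | (K * a n < W n w)%R] <= e%:E)%E) ->
  bigOp_add P Z a b.
Proof.
move=> C0 a0 b0 mZ mW mE ZE PE PW.
pose c n := 2 * C * b n.
exists (fun n => rv_of (P n) (tail (c n) (Z n))),
  (fun n => rv_of (P n) (fun w => Z n w - tail (c n) (Z n) w)); split.
- near=> n => w.
  have mZn : measurable_fun [set: T n] (Z n) by near: n.
  have mt := measurable_tail (c n) mZn.
  by rewrite !rv_ofE//; [rewrite subrKC|exact: measurable_funB].
- move=> e e0; have e2 : 0 < e / 2 by rewrite divr_gt0.
  have [K K0 hK] := PW _ e2.
  exists (2 * C * K); first by rewrite !mulr_gt0.
  near=> n.
  have mZn : measurable_fun [set: T n] (Z n) by near: n.
  have mWn : measurable_fun [set: T n] (W n) by near: n.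
  have mEn : measurable (E n) by near: n.
  rewrite rv_ofE; last exact: measurable_tail.
  have mt := measurable_tail (c n) mZn.
  apply: (@le_trans _ _ (P n (~` E n `|` [set w | K * a n < W n w]))).
    apply: le_measure; rewrite ?inE.
    - by apply: measurable_set_gt; exact: measurableT_comp.
    - apply: measurableU; first exact: measurableC.
      exact: measurable_set_gt.
    - move=> w /= hw; have [Ew|] := pselect (E n w); last by left.
      right; have ZEw : `|Z n w| <= C * (W n w + b n).
        by move: w {hw} Ew; near: n.
      move: hw; rewrite /tail; case: ifPn => [cZ h|_]; last first.
        by rewrite normr0 ltNge mulr_ge0// !mulr_ge0// ltW.
      have h2 : 2 * C * (K * a n) < 2 * C * W n w by rewrite /c in cZ; lra.
      by move: h2; rewrite ltr_pM2l// mulr_gt0.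
  apply: le_trans (measureU2 _ _ _) _ => //.
  - exact: measurableC.
  - exact: measurable_set_gt.
  rewrite [e]splitr EFinD; apply: leeD; near: n => //.
  exact: PE.
- move=> e e0; exists (2 * C); first by rewrite mulr_gt0.
  near=> n.
  have mZn : measurable_fun [set: T n] (Z n) by near: n.
  have mt := measurable_tail (c n) mZn.
  rewrite rv_ofE; last exact: measurable_funB.
  rewrite [X in P n X](_ : _ = set0) ?measure0 ?lee_fin ?(ltW e0)//.
  apply/seteqP; split=> // w /=; rewrite /tail -/(c n); case: ifPn => cZ.
    by rewrite subrr normr0 ltNge mulr_ge0// mulr_ge0// ltW.
  by rewrite subr0 => h; move: cZ; rewrite h.
Unshelve. all: by end_near.
Qed.

End BigOp.

(** * Rate of the averaged noise and proof of the theorem *)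

Section Assembly.
Context {R : realType}.

(** Eventually n1 / n < (1 + u) / 2, so the second stage keeps at least the fraction (1 - u) / 2 of
    the budget; rates in the number of replications thereby become rates in n. *)
Lemma replications_proportional (n1 n3 : nat -> nat) (G : nat) (u : R) :
  (\forall n \near \oo, (0 < n1 n < n)%N /\ (n1 n + n3 n * G)%N = n) ->
  u < 1 -> (fun n => (n1 n)%:R / n%:R : R) @ \oo --> u ->
  exists2 B : R, 0 < B &
    \forall n \near \oo, (0 < n3 n)%N /\ n%:R <= B * (n3 n)%:R.
Proof.
move=> hb u1 hlim.
exists (2 * (G%:R + 1) / (1 - u)).
  by rewrite divr_gt0 ?subr_gt0// mulr_gt0// ltr_wpDl.
have u2 : u < (1 + u) / 2 by lra.
near=> n.
have [/andP[n10 n1n] nE] : (0 < n1 n < n)%N /\ (n1 n + n3 n * G)%N = n by near: n.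
have hr : (n1 n)%:R / n%:R < (1 + u) / 2.
  by near: n; exact: (cvgr_lt _ hlim).
have n0 : 0 < n%:R :> R by rewrite ltr0n (leq_ltn_trans _ n1n).
rewrite ltr_pdivrMr// in hr.
have nR : n%:R = (n1 n)%:R + (n3 n)%:R * G%:R :> R by rewrite -natrM -natrD nE.
have key : (1 - u) / 2 * n%:R <= (n3 n)%:R * G%:R by lra.
split.
  rewrite lt0n; apply/negP => /eqP n30; move: n1n; rewrite -[ltnRHS]nE n30.
  by rewrite mul0n addn0 ltnn.
rewrite mulrAC ler_pdivlMr ?subr_gt0//.
have : 0 <= (n3 n)%:R :> R by [].
lra.
Unshelve. all: by end_near.
Qed.

Lemma noise_rate (disp : measure_display) (T : nat -> measurableType disp)
    (P : forall n, probability (T n) R) (J : finType) (q : nat -> nat)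
    (X : forall n, J * 'I_(q n) -> {RV (P n) >-> R}) (s B : R) :
  0 <= s ->
  (forall n i, 'E_(P n)[X n i] = 0%R%:E)%E ->
  (forall n i, 'V_(P n)[X n i] = s%:E)%E ->
  (forall n i j A A', i != j -> measurable A -> measurable A' ->
    P n (X n i @^-1` A `&` X n j @^-1` A') =
    P n (X n i @^-1` A) * P n (X n j @^-1` A'))%E ->
  0 < B -> (\forall n \near \oo, (0 < q n)%N /\ n%:R <= B * (q n)%:R) ->
  forall e : R, 0 < e -> exists2 K : R, 0 < K & \forall n \near \oo,
    (P n [set w | K * (Num.sqrt n%:R)^-1 <
       \sum_j `|(q n)%:R^-1 * \sum_(r < q n) X n (j, r) w|]%R <= e%:E)%E.
Proof.
move=> s0 EX VX indep B0 hq e e0.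
pose M : R := #|J|%:R ^+ 2 * s * B.
have M0 : 0 <= M by rewrite !mulr_ge0// ltW.
(* The tail is at most M / K^2 <= M / K <= e; the summand 1 gives K <= K^2. *)
exists (1 + M / e); first by rewrite ltr_wpDr// divr_ge0// ltW.
have K1 : 1 <= 1 + M / e by rewrite lerDl divr_ge0// ltW.
set K := 1 + M / e in K1 *.
near=> n.
have [q0 nq] : (0 < q n)%N /\ n%:R <= B * (q n)%:R by near: n.
have n0 : 0 < n%:R :> R by rewrite ltr0n; near: n; exact: nbhs_infty_gt.
have t0 : 0 < K * (Num.sqrt n%:R)^-1.
  by rewrite mulr_gt0 ?invr_gt0 ?sqrtr_gt0// (lt_le_trans ltr01).
apply: le_trans (noise_tail q0 t0 (EX n) (VX n) (indep n)) _.
rewrite lee_fin exprMn exprVn sqr_sqrtr ?(ltW n0)//.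
have qR : 0 < (q n)%:R :> R by rewrite ltr0n.
have K2 : K <= K ^+ 2 by rewrite expr2 ler_peMl// (le_trans ler01).
have -> : #|J|%:R ^+ 2 * s / (K ^+ 2 * n%:R^-1 * (q n)%:R) =
    #|J|%:R ^+ 2 * s * n%:R / (K ^+ 2 * (q n)%:R).
  by field; rewrite !lt0r_neq0//; apply: lt_le_trans K1.
have Kp : 0 < K by apply: lt_le_trans K1.
rewrite ler_pdivrMr ?mulr_gt0 ?exprn_gt0//.
apply: (@le_trans _ _ (M * (q n)%:R)).
  by rewrite /M -[leRHS]mulrA ler_wpM2l// mulr_ge0.
rewrite mulrA ler_wpM2r//.
apply: (@le_trans _ _ (e * K)); last by rewrite ler_pM2l.
rewrite /K mulrDr mulr1 mulrCA mulfV ?mulr1 ?lerDr ?(ltW e0)// lt0r_neq0//.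
Unshelve. all: by end_near.
Qed.

End Assembly.

Theorem theorem1 (R : realType) (d : nat) (d_gt0 : (0 < d)%N)
  (D : set 'rV[R]_d) (D_compact : compact D) (D_convex : convex_set D)
  (f : 'rV[R]_d -> R)
  (* (A1) *)
  (eps alpha L : R) (eps_gt0 : 0 < eps) (alpha_gt2 : 2 < alpha) (L_gt0 : 0 < L)
  (f_holder : holder_class alpha L (enlarge D eps) f)
  (* (A2) *)
  (mu : 'rV[R]_d) (M : R)
  (mu_argmax :
    unique (fun x => interior D x /\ forall y, D y -> f y <= f x) mu)
  (M_max : M = f mu) (M_sup : M = sup (f @` D))
  (hess_neg : lambda_max (hessian (enlarge D eps) f mu) < 0)
  (* l is the smallest integer with 2 l >= r *)
  (r := holder_order alpha) (l := uphalf r)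
  (* budget: n1 n first-stage observations, n3 n replications on the grid *)
  (n1 n3 : nat -> nat) (upsilon : R)
  (budget : \forall n \near \oo,
    (0 < n1 n < n)%N /\ (n1 n + n3 n * (2 * l + 1) ^ d)%N = n)
  (upsilon01 : 0 < upsilon < 1)
  (n1_lim : (fun n => (n1 n)%:R / n%:R) @ \oo --> upsilon)
  (* localization parameter *)
  (delta : nat -> R) (delta_gt0 : forall n, 0 < delta n)
  (delta_lim : delta @ \oo --> 0)
  (delta_large : (fun n => Num.sqrt n%:R * delta n ^+ 2) @ \oo --> +oo)
  (* probability spaces and observation errors *)
  (disp : measure_display) (T : nat -> measurableType disp)
  (P : forall n, probability (T n) R)
  (sigma : R) (xi : forall n, obs d l (n1 n) (n3 n) -> {RV (P n) >-> R})
  (xi_indep : forall n, mutually_independent (@xi n))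
  (xi_mean : forall n k, ('E_(P n)[xi n k] = 0%R%:E)%E)
  (xi_var : forall n k, ('V_(P n)[xi n k] = (sigma ^+ 2)%:E)%E)
  (* first stage *)
  (z : forall n, 'I_(n1 n) -> 'rV[R]_d)
  (c1 c2 : R) (c1_gt0 : 0 < c1) (c2_gt0 : 0 < c2)
  (z_unif : \forall n \near \oo, approx_uniform D c1 c2 n (@z n))
  (tau : forall n, (n1 n).-tuple R -> 'rV[R]_d)
  (tau_meas : forall n, measurable_vec (@tau n))
  (tau_D : forall n y, D (tau n y))
  (mut : forall n, T n -> 'rV[R]_d)
  (mut_def : forall n w,
    mut n w = tau n [tuple f (z n i) + xi n (inl i) w | i < n1 n])
  (mut_rate : littleop P (fun n w => enorm (mut n w - mu)) delta)
  (* second stage *)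
  (X : forall n, T n -> gindex d l * 'I_(n3 n) -> 'rV[R]_d)
  (X_def : forall n w k, X n w k = grid_point (mut n w) (delta n) k.1)
  (Y : forall n, T n -> gindex d l * 'I_(n3 n) -> R)
  (Y_def : forall n w k, Y n w k = f (X n w k) + xi n (inr k) w)
  (theta : forall n, T n -> {ffun mindex d r -> R})
  (theta_min : forall n w (theta' : {ffun mindex d r -> R}),
    rss (X n w) (Y n w) (theta n w) <= rss (X n w) (Y n w) theta')
  (muh : forall n, T n -> 'rV[R]_d) (muh_meas : forall n, measurable_vec (@muh n))
  (muh_argmax : forall n w, cube (mut n w) (l%:R * delta n) (muh n w) /\
    forall x, cube (mut n w) (l%:R * delta n) x ->
      poly_fun (theta n w) x <= poly_fun (theta n w) (muh n w))
  (Mh : forall n, T n -> R)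
  (Mh_def : forall n w, Mh n w = poly_fun (theta n w) (muh n w)) :
  bigOp_add P (fun n w => enorm (muh n w - mu))
    (fun n => (Num.sqrt n%:R)^-1 * (delta n)^-1)
    (fun n => delta n `^ (alpha - 1)) /\
  bigOp_add P (fun n w => Mh n w - M)
    (fun n => (Num.sqrt n%:R)^-1)
    (fun n => delta n `^ alpha).
Proof.
have [[mu_int mu_max] _] := mu_argmax.
have [B B0 hB] := replications_proportional budget (proj2 (andP upsilon01)) n1_lim.
have [C [h0 [C0 h00 hC]]] := two_stage_error d_gt0 eps_gt0 alpha_gt2 L_gt0
  f_holder mu_int mu_max hess_neg.
pose zeta n (k : gindex d l * 'I_(n3 n)) : {RV (P n) >-> R} := xi n (inr k).
(* The position of the grid does not enter S, so its tail bound is unaffected by the first stage. *)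
pose S n (w : T n) : R := \sum_j `|(n3 n)%:R^-1 * \sum_(s < n3 n) zeta n (j, s) w|.
have S_rate := @noise_rate R disp T P (gindex d l) n3 zeta (sigma ^+ 2) B
  (sqr_ge0 sigma) (fun n i => xi_mean n (inr i)) (fun n i => xi_var n (inr i)).
have {}S_rate := S_rate (fun n i j A A' ij => independent_pair (xi_indep n) (i := inr i)
    (j := inr j) ij) B0 hB.
have mxi n k : measurable_fun [set: T n] (xi n k) by exact: measurable_funPT.
have mS n : measurable_fun [set: T n] (S n).
  apply: measurable_sum => j; apply: measurableT_comp => //.
  apply: measurable_funM; first exact: measurable_cst.
  exact: measurable_sum.
have mmut n : measurable_vec (mut n).
  move=> k.
  have -> : (fun w => mut n w 0 k) = (fun y => tau n y 0 k) \o
      (fun w => [tuple f (z n i) + xi n (inl i) w | i < n1 n]).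
    by apply/funext => w; rewrite /= mut_def.
  apply: measurableT_comp; first exact: tau_meas.
  apply/measurable_fun_tnthP => i.
  rewrite (_ : _ \o _ = fun w => f (z n i) + xi n (inl i) w); last first.
    by apply/funext => w; rewrite /= tnth_mktuple.
  by apply: measurable_funD; first exact: measurable_cst.
have menorm n : measurable_fun [set: T n] (fun w => enorm (mut n w - mu)).
  apply: measurable_fun_enorm; apply: measurable_vecB => // k; exact: measurable_cst.
(* The event on which [two_stage_error] applies; its complement is controlled by the preliminary
   rate with constant 1. *)
pose E n := ~` [set w | delta n < enorm (mut n w - mu)].
have mE n : measurable (E n) by apply: measurableC; exact: measurable_set_gt.
have PE (e : R) : 0 < e -> \forall n \near \oo, (P n (~` E n) <= e%:E)%E.
  move=> e0; have /fine_cvgP[fin /cvgr_lt/(_ _ e0) lte] := mut_rate 1 ltr01.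
  near=> n; rewrite setCK.
  have -> : [set w | delta n < enorm (mut n w - mu)] =
      [set w | 1 * delta n < `|enorm (mut n w - mu)|].
    by apply: eq_set => w; rewrite mul1r ger0_norm// enorm_ge0.
  rewrite -[leLHS]fineK; last by near: n.
  by rewrite lee_fin ltW//; near: n.
(* The first bound serves the error estimate; the second keeps the grid in the interior of the
   enlargement for every w, even outside E, for measurability of the observations. *)
have small : \forall n \near \oo, delta n < Num.min h0 (eps / (d%:R + 1) / (l%:R + 1)).
  apply: (cvgr_lt _ delta_lim).
  by rewrite lt_min h00 !divr_gt0// ltr_wpDl.
have l0 : 0 <= l%:R :> R by [].
have Sge0 n w : 0 <= S n w by apply: sumr_ge0.
have bound : \forall n \near \oo, forall w, E n w ->
    enorm (muh n w - mu) <= C * (S n w / delta n + delta n `^ (alpha - 1)) /\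
    `|Mh n w - M| <= C * (S n w + delta n `^ alpha).
  near=> n => w /negP; rewrite -leNgt => Enw.
  have [q0 _] : (0 < n3 n)%N /\ n%:R <= B * (n3 n)%:R by near: n.
  have /andP[dh _] : (delta n < h0) && (delta n < eps / (d%:R + 1) / (l%:R + 1)).
    by rewrite -lt_min; near: n.
  have [muhc muhm] := muh_argmax n w.
  rewrite Mh_def M_max.
  have dn : 0 < delta n < h0 by rewrite delta_gt0.
  apply: (hC (mut n w) (delta n) (n3 n) (fun k => zeta n k w) (theta n w)
    (muh n w) dn q0 Enw _ muhc muhm) => th'.
  have := theta_min n w th'.
  have -> : X n w = fun k => grid_point (mut n w) (delta n) k.1 by apply/funext => k.
  have -> : Y n w = fun k => f (grid_point (mut n w) (delta n) k.1) + zeta n k w.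
    by apply/funext => k; rewrite Y_def X_def.
  by [].
have mMh : \forall n \near \oo, measurable_fun [set: T n] (Mh n).
  near=> n.
  have [q0 _] : (0 < n3 n)%N /\ n%:R <= B * (n3 n)%:R by near: n.
  have /andP[_ de] : (delta n < h0) && (delta n < eps / (d%:R + 1) / (l%:R + 1)).
    by rewrite -lt_min; near: n.
  have dn0 := lt0r_neq0 (delta_gt0 n).
  have rl : (r <= l.*2)%N by exact: double_uphalf_ge.
  have [Pi hPi] := fitted_values_linear (R := R) (d := d) r l (n3 n).
  have mY k : measurable_fun [set: T n] (fun w => Y n w k).
    under eq_fun do rewrite Y_def X_def.
    apply: measurable_funD => //.
    apply: (measurable_fun_comp_continuous (U := interior (enlarge D eps))).
    - exact: measurable_vec_grid.
    - exact: open_interior.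
    - move=> x Ax; apply: differentiable_continuous.
      exact: (holder_differentiable alpha_gt2 f_holder).
    - move=> w; have Dw : D (mut n w) by rewrite mut_def; exact: tau_D.
      apply: (enlarge_interior eps_gt0 Dw).
      apply: le_lt_trans (_ : (l%:R + 1) * delta n < _); last first.
        by rewrite mulrC -ltr_pdivlMr// ltr_wpDl.
      apply: norm_le_coord => [|t]; first by rewrite mulr_ge0// ?addr_ge0// ltW.
      rewrite !mxE addrAC subrr add0r normrM (gtr0_norm (delta_gt0 n)).
      rewrite ler_wpM2r ?(ltW (delta_gt0 n))//.
      have : (k.1 t)%:R <= l.*2%:R :> R by rewrite ler_nat -ltnS ltn_ord.
      have -> : l.*2%:R = l%:R + l%:R :> R by rewrite -addnn natrD.
      have : 0 <= (k.1 t)%:R :> R by [].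
      by move=> ? ?; rewrite ler_norml; apply/andP; split; lra.
  (* The coefficients are eliminated: the fit at [muh] is interpolated from fitted values, linear in
     the data. Any replicate gives the same fitted value, and [Ordinal q0] picks one since there is
     at least one. *)
  have -> : Mh n = fun w => \sum_(j : gindex d l)
      lag j ((delta n)^-1 *: (muh n w - mut n w)) *
      \sum_k' Pi (j, Ordinal q0) k' * Y n w k'.
    apply/funext => w; rewrite Mh_def (poly_fun_lagrange _ (mut n w) _ dn0 rl).
    apply: eq_bigr => j _; congr (_ * _).
    apply: (hPi (mut n w) (delta n) (Y n w) (theta n w) dn0 _ (j, Ordinal q0)) => th'.
    have := theta_min n w th'.
    by have -> : X n w = fun k => grid_point (mut n w) (delta n) k.1 by apply/funext => k.
  apply: measurable_sum => j; apply: measurable_funM.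
    apply: measurable_fun_lag; apply: measurable_vecZ; exact: measurable_vecB.
  apply: measurable_sum => k; apply: measurable_funM; first exact: measurable_cst.
  exact: mY.
split.
- apply: (bigOp_add_of_bound (W := fun n w => S n w / delta n) (C := C) (E := E)) => //.
  + by move=> n; rewrite mulr_ge0// invr_ge0// ltW.
  + by move=> n; exact: powR_ge0.
  + near=> n; apply: measurable_fun_enorm; apply: measurable_vecB => k.
      exact: muh_meas.
    exact: measurable_cst.
  + near=> n; apply: measurable_funM => //; exact: mS.
  + by near=> n.
  + near=> n => w Ew; rewrite ger0_norm ?enorm_ge0//.
    by move: w Ew; near: n; apply: filterS bound => n h w /h[].
  + move=> e e0; have [K K0 hK] := S_rate _ e0; exists K => //.
    apply: filterS hK => n; congr (P n _ <= _)%E.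
    by apply: eq_set => w; rewrite mulrA ltr_pM2r// invr_gt0.
- apply: (bigOp_add_of_bound (W := S) (C := C) (E := E)) => //.
  + by move=> n; exact: powR_ge0.
  + apply: filterS mMh => n mMhn; apply: measurable_funB => //; exact: measurable_cst.
  + by near=> n.
  + by near=> n.
  + by apply: filterS bound => n h w /h[].
Unshelve. all: by end_near.
Qed.
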